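(* Suppose that $f$ is a transcendental entire function and there exists a sequence $(D_n)_{n\in\mathbb{N}_0}$ of bounded, simply connected domains in $\mathbb{C}$ such that (a) $f(\partial D_n)$ surrounds $D_{n+1}$, for all $n\in\mathbb{N}_0$; and (b) every disc centred at $0$ is contained in $D_n$ for all sufficiently large $n$. Then the set $I^{+}(f)=\{z\in\mathbb{C}:(f^n(z))_{n\in\mathbb{N}}\text{ is unbounded}\}$ is connected.
   Context: $\mathbb{N}_0=\mathbb{N}\cup\{0\}$. $f^n$ denotes the $n$th iterate of $f$. A transcendental entire function is an entire function that is not a polynomial. A domain is a non-empty connected open set. A set $A\subset\mathbb{C}$ surrounds a set $B\subset\mathbb{C}$ if $B$ lies in a bounded component of the complement $\mathbb{C}\setminus A$. *)

(* Defs.v *)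
From HB Require Import structures.
From mathcomp Require Import all_boot all_order all_algebra.
From mathcomp Require Import complex.
From mathcomp Require Import all_classical all_reals all_analysis.

Set Implicit Arguments.
Unset Strict Implicit.
Unset Printing Implicit Defensive.

Import Order.TTheory GRing.Theory Num.Theory.
Import numFieldNormedType.Exports.

Local Open Scope classical_set_scope.
Local Open Scope complex_scope.
Local Open Scope ring_scope.

(* [numFieldNormedType.Exports] provides the norm topology only for variables of
   type [numClosedFieldType], not for the concrete type [R[i]]. *)
HB.instance Definition _ (R : rcfType) := NormedModule.copy R[i] R[i]^o.

(* The field of scalars is [R[i]] itself, so that [derivable f z 1] is complex
   differentiability: [(f (z + h) - f z) / h] converges as the complex number
   [h] tends to 0. *)
Definition entire (R : realType) (f : R[i] -> R[i]) : Prop :=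
  forall z : R[i], derivable f z 1.

Definition transcendental_entire (R : realType) (f : R[i] -> R[i]) : Prop :=
  entire f /\ ~ exists p : {poly R[i]}, forall z, f z = p.[z].

Definition domain (R : realType) (D : set R[i]) : Prop :=
  [/\ D !=set0, connected D & open D].

Definition frontier (T : topologicalType) (A : set T) : set T :=
  closure A `\` interior A.

(* Every loop in [D] is null-homotopic in [D] relative to its base point;
   [H] is the homotopy, with the deformation parameter as first coordinate.
   Path-connectedness is not repeated here: the predicate is only used
   together with [domain], and plane domains are path-connected. *)
Definition simply_connected (R : realType) (D : set R[i]) : Prop :=
  forall gamma : R -> R[i],
    {within `[0, 1], continuous gamma} ->
    gamma @` `[0, 1] `<=` D ->
    gamma 0 = gamma 1 ->
    exists H : R * R -> R[i],
      [/\ {within `[0, 1] `*` `[0, 1], continuous H},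
          H @` (`[0, 1] `*` `[0, 1]) `<=` D,
          forall t, t \in `[0, 1] -> H (0, t) = gamma t,
          forall t, t \in `[0, 1] -> H (1, t) = gamma 0 &
          forall s, s \in `[0, 1] -> H (s, 0) = gamma 0 /\ H (s, 1) = gamma 0].

(* [~ A x] makes [connected_component (~` A) x] a genuine component: it is
   [set0] otherwise. *)
Definition surrounds (R : realType) (A B : set R[i]) : Prop :=
  exists x : R[i],
    [/\ ~ A x,
        bounded_set (connected_component (~` A) x) &
        B `<=` connected_component (~` A) x].

Definition unbounded_orbit_set (R : realType) (f : R[i] -> R[i]) : set R[i] :=
  [set z | ~ bounded_set [set iter n f z | n in [set n | (0 < n)%N]]].

(* Main.v *)
(** The key point is that a compact connected set [K] of points with bounded orbits has
    uniformly bounded orbits.  If the orbits of a connected set [L] are uniformly bounded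
    and one of its points has its orbit in the disc of radius [m], then the orbits of [L]
    lie in a disc whose radius [rho] depends only on [m]: once [f^n(L)] leaves [D M], with
    [D M], [D M.+1], ... containing the disc of radius [m], it meets the boundary of [D M],
    hence [f^(n+1)(L)] leaves [D M.+1], and so on, out to infinity.  By boundary bumping, if
    [K] is not uniformly bounded, then for each [m] it has a subcontinuum which is not
    uniformly bounded either and avoids the closed set of points with orbits in the disc
    of radius [m]; a nested intersection of such subcontinua is nonempty and consists of
    points with unbounded orbits.

    Suppose now that disjoint open sets [U0] and [U1] separate [w0] from [w1] in the set of
    unbounded orbits.  Every component [K] of [X = ~` (U0 `|` U1)] is then compact with
    uniformly bounded orbits, so by the maximum modulus principle for the iterates of [f]
    neither [w0] nor [w1] lies in a hole of [K], and [(z - w0) / (z - w1)] has a continuous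
    argument on a neighbourhood of [K].  By compactness it has a continuous argument on the
    whole of [X], and this contradicts the fact that [X] separates [w0] from [w1].

    The maximum modulus principle is derived from Goursat's lemma: [f] has a primitive
    [F], the difference quotients of [F] are twice differentiable, so that the second
    derivative test applies to them, and they converge to [f] locally uniformly. *)
Require Import Defs.
From HB Require Import structures.
From mathcomp Require Import all_boot all_order all_algebra.
From mathcomp Require Import complex ring lra.
From mathcomp Require Import all_classical all_reals all_analysis.

Set Implicit Arguments.
Unset Strict Implicit.
Unset Printing Implicit Defensive.

Import Order.TTheory GRing.Theory Num.Theory.
Import numFieldNormedType.Exports.
Import ComplexField.Normc.

Local Open Scope classical_set_scope.
Local Open Scope complex_scope.
Local Open Scope ring_scope.

(** * Components of compact sets *)

Section topology.
Variable T : topologicalType.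
Implicit Types A B K O S : set T.

(** The sets whose removal from [K] leaves a set satisfying [P] form a filter, proper if [P K]
    fails. A cluster point of it in [K] has a neighbourhood satisfying [P], whose complement belongs
    to the filter: a contradiction. *)
Lemma compact_set_ind K (P : set T -> Prop) : compact K -> P set0 ->
  (forall A B, P A -> P B -> P (A `|` B)) ->
  (forall A B, A `<=` B -> P B -> P A) ->
  (forall x, K x -> exists2 U, nbhs x U & P U) -> P K.
Proof.
move=> cK P0 PU PS Ploc; apply: contrapT => nPK.
pose F : set_system T := fun A => P (K `\` A).
have FF : ProperFilter F.
  split; first by rewrite /F setD0.
  split.
  - by rewrite /F setDT.
  - by move=> A B FA FB; rewrite /F setDIr; exact: PU.
  - by move=> A B AB; apply: PS; exact: setDS.
have [|x [Kx clx]] := cK F FF; first by rewrite /F setDv.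
have [U Ux PPU] := Ploc x Kx.
have [|y [/= nUy Uy]] := clx (~` U) U _ Ux; last by [].
by apply: PS PPU => y [_ /contrapT].
Qed.

Lemma connected_closed_cover A B C : connected A -> closed B -> closed C ->
  A `<=` B `|` C -> A `&` B `&` C = set0 -> A `&` B !=set0 -> A `<=` B.
Proof.
move=> Ac cB cC ABC ABC0 AB0.
suff <- : A `&` B = A by move=> ? [].
apply: Ac => //; last by exists B.
exists (~` C); first exact: closed_openC.
rewrite predeqE => x; split=> [[Ax Bx]|[Ax nCx]]; split => //.
  by move=> Cx; have : (A `&` B `&` C) x by []; rewrite ABC0.
by case: (ABC _ Ax).
Qed.

(** If [A] missed the frontier of [B], the closure of [B] and the complement of [B] would split [A]
    into disjoint relatively closed pieces. *)
Lemma connected_meets_frontier A B : connected A -> open B ->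
  A `&` B !=set0 -> ~ A `<=` B -> A `&` (closure B `\` B) !=set0.
Proof.
move=> Ac oB AB nAB; apply: contrapT => AB0; apply: nAB.
suff : A `<=` closure B.
  move=> AclB x Ax; apply: contrapT => nBx; apply: AB0.
  by exists x; split => //; split => //; exact: AclB.
apply: (connected_closed_cover (C := ~` B)) => //.
- exact: closed_closure.
- exact: open_closedC.
- move=> x _; have [Bx|] := pselect (B x); last by right.
  by left; exact: subset_closure.
- rewrite -subset0 => x [[Ax clBx] nBx]; apply: AB0.
  by exists x.
- by case: AB => x [Ax Bx]; exists x; split => //; exact: subset_closure.
Qed.

Hypothesis Th : hausdorff_space T.
Hypothesis Tn : forall A B, closed A -> closed B -> A `&` B = set0 ->
  exists U V, [/\ open U, open V, A `<=` U, B `<=` V & U `&` V = set0].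

(** For closed [K] these are the relatively clopen parts of [K] around [x]; their intersection is
    the quasi-component of [x]. *)
Definition clopen_part K x := [set A | [/\ closed A, closed (K `\` A), A `<=` K & A x]].

Lemma clopen_partI K x A B : closed K ->
  clopen_part K x A -> clopen_part K x B -> clopen_part K x (A `&` B).
Proof.
move=> cK [cA cKA AK Ax] [cB cKB BK Bx]; split => //.
- exact: closedI.
- by rewrite setDIr; exact: closedU.
- by move=> y [/AK].
Qed.

(** Each point of [K] outside [O] is excluded by some clopen part. By compactness finitely many
    suffice, and their intersection is again a clopen part. *)
Lemma clopen_part_sub_open K x O : compact K -> K x -> open O ->
  \bigcap_(A in clopen_part K x) A `<=` O ->
  exists2 A, clopen_part K x A & A `<=` O.
Proof.
move=> cptK Kx oO sub.
have cK : closed K by exact: compact_closed.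
have PK : clopen_part K x K by split => //; rewrite setDv; exact: closed0.
have : exists2 A, clopen_part K x A & A `&` (K `\` O) = set0.
  apply: (compact_set_ind (P := fun S => exists2 A, clopen_part K x A & A `&` S = set0)).
  - apply: (subclosed_compact _ cptK); last by move=> ? [].
    by rewrite setDE; apply: closedI => //; exact: open_closedC.
  - by exists K => //; rewrite setI0.
  - move=> A B [A' PA' A'A] [B' PB' B'B]; exists (A' `&` B').
      exact: clopen_partI.
    rewrite -subset0 => y [[A'y B'y] [Ay|By]].
      by rewrite -A'A.
    by rewrite -B'B.
  - move=> A B AB [B' PB' B'B]; exists B' => //.
    by rewrite -subset0 => y [B'y /AB By]; rewrite -B'B.
  - move=> y [Ky nOy].
    have [A PA nAy] : exists2 A, clopen_part K x A & ~ A y.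
      apply: contrapT => H; apply: nOy; apply: sub => A PA.
      by apply: contrapT => nAy; apply: H; exists A.
    exists (~` A); last by exists A => //; rewrite setICr.
    by apply: open_nbhs_nbhs; split => //; apply: closed_openC; case: PA.
move=> [A PA AKO]; exists A => // y Ay; apply: contrapT => nOy.
by have : (A `&` (K `\` O)) y; [split => //; split => //; case: PA => _ _ + _; apply | rewrite AKO].
Qed.

(** Two disjoint closed pieces of the quasi-component have disjoint open neighbourhoods by
    normality. A clopen part inside their union can be cut down to the neighbourhood of the piece
    containing [x], so the other piece is empty. *)
Lemma bigcap_clopen_part_connected K x : compact K -> K x ->
  connected (\bigcap_(A in clopen_part K x) A).
Proof.
move=> cptK Kx; set Q := \bigcap_(A in _) A.
have cK : closed K by exact: compact_closed.
have Qx : Q x by move=> A [].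
have cQ : closed Q by apply: closed_bigI => A [].
move=> B B0 [C oC BQC] [D cD BQD].
have cB : closed B by rewrite BQD; exact: closedI.
have cB' : closed (Q `\` B).
  have -> : Q `\` B = Q `&` ~` C.
    rewrite BQC; apply/seteqP; split => y [Qy].
      by move=> h; split => // Cy; apply: h.
    by move=> nCy; split => // -[].
  by apply: closedI => //; exact: open_closedC.
have dis : B `&` (Q `\` B) = set0 by rewrite setDE setICA setICr setI0.
have BQ : B `<=` Q by rewrite BQC => ? [].
have key E E' : closed E -> closed E' -> E `|` E' = Q -> E `&` E' = set0 -> E x -> E' = set0.
  move=> cE cE' EE' EE'0 Ex.
  have [U [V [oU oV EU E'V UV0]]] := Tn cE cE' EE'0.
  have [||A PA AUV] := clopen_part_sub_open (O := U `|` V) cptK Kx.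
  - exact: openU.
  - by rewrite -/Q -EE' => y [/EU|/E'V]; [left|right].
  have PAU : clopen_part K x (A `&` U).
    case: PA => cA cKA AK Ax.
    (* Cutting [A] by [U] amounts to removing the open set [V], so the cut part stays closed. *)
    have AUE : A `&` U = A `&` ~` V.
      apply/seteqP; split => y [Ay].
        by move=> Uy; split => // Vy; have : (U `&` V) y by []; rewrite UV0.
      by move=> nVy; split => //; case: (AUV _ Ay).
    split.
    - by rewrite AUE; apply: closedI => //; exact: open_closedC.
    - have -> : K `\` (A `&` U) = (K `\` A) `|` (A `&` ~` U).
        rewrite setDIr; apply/seteqP; split => y [|].
        + by left.
        + move=> [Ky nUy]; have [Ay|] := pselect (A y); by [right|left].
        + by left.
        + by move=> [Ay nUy]; right; split => //; exact: AK.
      by apply: closedU => //; apply: closedI => //; exact: open_closedC.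
    - by move=> y [/AK].
    - by split => //; exact: EU.
  rewrite -subset0 => y E'y.
  have /(_ _ PAU)[_ Uy] : Q y by rewrite -EE'; right.
  by rewrite -UV0; split => //; exact: E'V.
have [Bx|nBx] := pselect (B x).
  have := key _ _ cB cB' (setDUK BQ) dis Bx.
  by rewrite setD_eq0 => QB; apply/seteqP.
have : B = set0.
  apply: (key _ _ cB' cB).
  - by rewrite setUC; exact: setDUK.
  - by rewrite setIC.
  - by [].
by move=> B00; case: B0; rewrite B00.
Qed.

(** This is the Sura-Bura lemma: the quasi-component is connected, hence contained in the
    component. *)
Lemma component_clopen_part K x O : compact K -> K x -> open O ->
  connected_component K x `<=` O -> exists2 A, clopen_part K x A & A `<=` O.
Proof.
move=> cptK Kx oO KO; apply: clopen_part_sub_open => //.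
apply: subset_trans KO; apply: connected_component_max.
- by move=> A [].
- move=> y; apply; split => //; first exact: compact_closed.
  by rewrite setDv; exact: closed0.
- exact: bigcap_clopen_part_connected.
Qed.

(* A component of [K `\` O] must reach the closure of [O], since otherwise it
   would be separated from it by a clopen part of [K]. *)
Lemma component_meets_closure K O x : compact K -> connected K -> open O ->
  K `&` O !=set0 -> K x -> ~ O x ->
  connected_component (K `\` O) x `&` closure O !=set0.
Proof.
move=> cptK Kc oO [y [Ky Oy]] Kx nOx; apply: contrapT => H.
have cK : closed K by exact: compact_closed.
have cptKO : compact (K `\` O).
  apply: (subclosed_compact _ cptK); last by move=> ? [].
  by rewrite setDE; apply: closedI => //; exact: open_closedC.
have [||||A [cA cKA AK Ax] AO] := @component_clopen_part (K `\` O) x (~` closure O).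
- by [].
- by [].
- exact/closed_openC/closed_closure.
- by move=> z Kz clz; apply: H; exists z.
suff KA : K `<=` A by have [_] := AK _ (KA _ Ky).
apply: (connected_closed_cover (C := ((K `\` O) `\` A) `|` (closure O))) => //.
- by apply: closedU => //; exact: closed_closure.
- move=> z Kz; have [Az|nAz] := pselect (A z); first by left.
  right; have [Oz|nOz] := pselect (O z); first by right; exact: subset_closure.
  by left.
- rewrite -subset0 => z [[Kz Az] [[]//|]].
  exact: AO.
- by exists x.
Qed.

(** A substitute for the component of [x] in [K] minus [B], built from compact pieces. It need not
    be closed, and it is its closure that reaches [B]. *)
Definition subcontinua K B x : set T :=
  \bigcup_(L in [set L | [/\ compact L, connected L, L `<=` K, L x & L `&` B = set0]]) L.

(** Boundary bumping. If the closure missed [B], normality would give disjoint open sets [O] around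
    [B] and [V] around the closure. The component of [x] in [K] minus [O] is one of the continua, so
    it lies in [V], yet it meets the closure of [O]. *)
Lemma subcontinua_closure_meets K B x : compact K -> connected K -> closed B ->
  K `&` B !=set0 -> K x -> ~ B x -> closure (subcontinua K B x) `&` B !=set0.
Proof.
move=> cptK Kc cB KB Kx nBx; apply: contrapT => H.
set S := subcontinua K B x in H.
have [|O [V [oO oV BO SV OV]]] := Tn cB (@closed_closure _ S).
  by rewrite -subset0 => y [By Sy]; apply: H; exists y.
have cK : closed K by exact: compact_closed.
have Sx : S x.
  exists [set x] => //; split => //.
  - exact: compact_set1.
  - exact: connected1.
  - by move=> _ ->.
  - by rewrite -subset0 => y [->].
have nOx : ~ O x.
  move=> Ox; have : (O `&` V) x by split => //; apply: SV; exact: subset_closure.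
  by rewrite OV.
have KO : K `&` O !=set0 by case: KB => y [Ky By]; exists y; split => //; exact: BO.
have [z [Kz clz]] := component_meets_closure cptK Kc oO KO Kx nOx.
have cKO : closed (K `\` O).
  by rewrite setDE; apply: closedI => //; exact: open_closedC.
have Sz : S z.
  exists (connected_component (K `\` O) x) => //; split => //.
  - apply: (subclosed_compact _ cptK); first exact: component_closed.
    by move=> y /connected_component_sub[].
  - exact: component_connected.
  - by move=> y /connected_component_sub[].
  - exact: connected_component_refl.
  - by rewrite -subset0 => y [/connected_component_sub[_ nOy] /BO].
have [] := clz V.
  by apply: open_nbhs_nbhs; split => //; apply: SV; exact: subset_closure.
by move=> y [Oy Vy]; have : (O `&` V) y by []; rewrite OV.
Qed.

Lemma subcontinua_connected K B x : connected (subcontinua K B x).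
Proof. by apply: bigcup_connected; [exists x => L []|move=> L []]. Qed.

Lemma nested_compact_nonempty (K : nat -> set T) : (forall n, compact (K n)) ->
  (forall n, K n !=set0) -> (forall n, K n.+1 `<=` K n) ->
  \bigcap_n K n !=set0.
Proof.
move=> cK K0 Kdec; apply: contrapT => H.
have Kle m n : (m <= n)%N -> K n `<=` K m.
  move=> /subnKC <-; elim: (n - m)%N => [|k IH]; first by rewrite addn0.
  by rewrite addnS; apply: subset_trans IH; exact: Kdec.
suff [n K0n] : exists n, K 0%N `&` K n = set0.
  have [y Kny] := K0 n; have : (K 0%N `&` K n) y; last by rewrite K0n.
  by split => //; exact: (Kle 0%N n).
apply: (compact_set_ind (P := fun S => exists n, S `&` K n = set0) (cK 0%N)).
- by exists 0%N; rewrite set0I.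
- move=> A B [n An] [m Bm]; exists (maxn n m); rewrite -subset0 => y [[Ay|By] Ky].
    by rewrite -An; split => //; apply: Kle Ky; rewrite leq_maxl.
  by rewrite -Bm; split => //; apply: Kle Ky; rewrite leq_maxr.
- move=> A B AB [n Bn]; exists n; rewrite -subset0 => y [/AB By Ky].
  by rewrite -Bn.
- move=> x _.
  have [n nKx] : exists n, ~ K n x.
    by apply: contrapT => h; apply: H; exists x => n _; apply: contrapT => ?; apply: h; exists n.
  exists (~` K n); last by exists n; rewrite setICl.
  by apply: open_nbhs_nbhs; split => //; apply: closed_openC; exact: compact_closed.
Qed.

End topology.

(** * The topology of the complex plane *)

Section complex_topology.
Variable R : realType.
Local Notation C := R[i].
Local Notation Re := (@complex.Re R).
Local Notation Im := (@complex.Im R).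
Implicit Types (z w : C) (A : set C).

(** The norm of [R[i]] takes its values in [R[i]]; estimates are carried out with the real-valued
    [normc] instead. *)
Lemma normrcE z : `|z| = (normc z)%:C.
Proof. by []. Qed.

Lemma normc_ge0 z : 0 <= normc z.
Proof. by rewrite -lecR -normrcE normr_ge0. Qed.

Lemma ler_normcD z w : normc (z + w) <= normc z + normc w.
Proof. exact: le_normcD. Qed.

Lemma normc_opp z : normc (- z) = normc z.
Proof. exact: normcN. Qed.

Lemma normc_distC z w : normc (z - w) = normc (w - z).
Proof. by rewrite -normc_opp opprB. Qed.

Lemma ler_normcB z w : normc z - normc w <= normc (z - w).
Proof. by rewrite lerBlDr; apply: le_trans (ler_normcD _ _); rewrite subrK. Qed.

Lemma normc_triangle z w u : normc (z - u) <= normc (z - w) + normc (w - u).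
Proof. by apply: le_trans (ler_normcD _ _); rewrite addrA subrK. Qed.

Lemma ler_Re_normc z : `|Re z| <= normc z.
Proof.
case: z => a b /=; rewrite -sqrtr_sqr ler_wsqrtr // lerDl; exact: sqr_ge0.
Qed.

Lemma ler_Im_normc z : `|Im z| <= normc z.
Proof.
case: z => a b /=; rewrite -sqrtr_sqr ler_wsqrtr // lerDr; exact: sqr_ge0.
Qed.

Lemma ler_normc_ReIm z : normc z <= `|Re z| + `|Im z|.
Proof.
case: z => a b /=; rewrite -[leRHS]ger0_norm ?addr_ge0 // -sqrtr_sqr ler_wsqrtr //.
by rewrite sqrrD !real_normK ?num_real // lerD2r lerDl mulrn_wge0 // mulr_ge0.
Qed.

Lemma normc_real (x : R) : normc x%:C = `|x|.
Proof. by rewrite /= expr0n addr0 sqrtr_sqr. Qed.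

Lemma normc_eq0 z : (normc z == 0) = (z == 0).
Proof. by apply/eqP/eqP => [/eq0_normc //|->]; exact: normc0. Qed.

Lemma normc_gt0 z : (0 < normc z) = (z != 0).
Proof. by rewrite lt_neqAle normc_ge0 andbT eq_sym normc_eq0. Qed.

Lemma nbhsCP z A : nbhs z A <->
  exists2 e : R, 0 < e & forall w, normc (w - z) < e -> A w.
Proof.
split.
  (* The radius [e] is a positive element of [R[i]], hence real. *)
  move/nbhs_ballP => [e /= e0 eA]; exists (Re e).
    by move: e0; rewrite ltcE => /andP[].
  move=> w wz; apply: eA; rewrite -ball_normE /= distrC normrcE ltcE /= wz andbT.
  by move: e0; rewrite ltcE => /andP[].
move=> [e e0 eA]; apply/nbhs_ballP; exists e%:C; first by rewrite /= ltcR.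
by move=> w; rewrite -ball_normE /= distrC normrcE ltcR => /eA.
Qed.

Lemma ball0CE (r : R) z : ball (0 : C) r%:C z = (normc z < r) :> Prop.
Proof. by rewrite -ball_normE /= sub0r normrN normrcE ltcR. Qed.

Lemma continuous_toRP (f : C -> R) z : {for z, continuous f} <->
  forall e, 0 < e -> exists2 d, 0 < d & forall w, normc (w - z) < d -> `|f w - f z| < e.
Proof.
split => [fc e e0|H].
  move/cvgrPdist_lt : fc => /(_ _ e0) /nbhsCP[d d0 dP].
  by exists d => // w /dP; rewrite distrC.
apply/(@cvgrPdist_lt _ _ _ (nbhs z)) => e e0; have [d d0 dP] := H e e0.
by apply/nbhsCP; exists d => // w /dP; rewrite distrC.
Qed.

Lemma cvg_toCP (T : Type) (F : set_system T) (FF : Filter F) (f : T -> C) (l : C) :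
  f x @[x --> F] --> l <->
  forall e : R, 0 < e -> \forall x \near F, normc (f x - l) < e.
Proof.
split=> [fl e e0|H].
  by apply: (fl [set w | normc (w - l) < e]); apply/nbhsCP; exists e.
move=> A /nbhsCP[e e0 eA]; have := H e e0.
by apply: filterS => x /= /eA.
Qed.

Lemma continuous_Re : continuous (Re : C -> R).
Proof.
move=> z; apply/continuous_toRP => e e0; exists e => // w; apply: le_lt_trans.
by have := ler_Re_normc (w - z); case: w; case: z.
Qed.

Lemma continuous_Im : continuous (Im : C -> R).
Proof.
move=> z; apply/continuous_toRP => e e0; exists e => // w; apply: le_lt_trans.
by have := ler_Im_normc (w - z); case: w; case: z.
Qed.

Lemma continuous_normc : continuous (@normc R : C -> R).
Proof.
move=> z; apply/continuous_toRP => e e0; exists e => // w; apply: le_lt_trans.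
rewrite ler_norml ler_normcB andbT lerNl opprB normc_distC.
exact: ler_normcB.
Qed.

Lemma cvg_complex (T : Type) (F : set_system T) (FF : Filter F) (f g : T -> R) (a b : R) :
  f x @[x --> F] --> a -> g x @[x --> F] --> b ->
  (f x +i* g x) @[x --> F] --> a +i* b.
Proof.
move=> fa gb; apply/cvg_toCP => e e0.
have e20 : 0 < e / 2 by rewrite divr_gt0.
move/cvgrPdist_lt : fa => /(_ _ e20); apply: filter_app.
move/cvgrPdist_lt : gb => /(_ _ e20); apply: filterS => x gx fx.
apply: le_lt_trans (ler_normc_ReIm _) _; rewrite /= (splitr e).
by rewrite distrC [`|g x - b|]distrC; exact: ltrD.
Qed.

Lemma compact_closed_ballC (r : R) : compact [set z : C | normc z <= r].
Proof.
pose h (p : R * R) : C := p.1 +i* p.2.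
have hc : continuous h.
  by move=> p; apply: cvg_complex; [exact: cvg_fst|exact: cvg_snd].
have cB : compact (h @` (`[- r, r] `*` `[- r, r])).
  apply: continuous_compact; first exact: continuous_subspaceT.
  by apply: compact_setX; exact: segment_compact.
apply: (subclosed_compact _ cB).
  rewrite (_ : [set z | _] = @normc R @^-1` [set x | x <= r]) //.
  by apply: closed_comp; [move=> ? _; exact: continuous_normc|exact: closed_le].
move=> z /= zr; exists (Re z, Im z); last by case: z zr.
split; rewrite /= in_itv /= -ler_norml; apply: le_trans zr.
  exact: ler_Re_normc.
exact: ler_Im_normc.
Qed.

Lemma bounded_setCP A : bounded_set A <-> exists r : R, forall z, A z -> normc z <= r.
Proof.
split.
  move=> [_ [/complex_realP[k ->] MA]]; exists (k + 1) => z Az.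
  have : k%:C < (k + 1)%:C by rewrite ltcR ltrDl.
  by move=> /MA /(_ z Az); rewrite /= normrcE lecR.
move=> [r rA]; exists r%:C; split; first by rewrite complex_real.
by move=> M rM z /rA zr /=; apply: le_trans (ltW rM); rewrite normrcE lecR.
Qed.

Lemma compactC A : (exists r : R, forall z, A z -> normc z <= r) -> closed A -> compact A.
Proof. by move=> [r rA] cA; exact: (subclosed_compact cA (@compact_closed_ballC r)). Qed.

Lemma compactC_bounded A : compact A -> exists2 r : R, 0 < r & forall z, A z -> normc z < r.
Proof.
move=> cA.
apply: (compact_set_ind (P := fun S => exists2 r : R, 0 < r & forall z, S z -> normc z < r) cA).
- by exists 1.
- move=> S S' [r r0 Sr] [r' r'0 S'r']; exists (Num.max r r'); first by rewrite lt_max r0.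
  by move=> z [/Sr|/S'r'] h; rewrite lt_max h ?orbT.
- by move=> S S' SS' [r r0 S'r]; exists r => // z /SS' /S'r.
- move=> z _; exists [set w | normc (w - z) < 1]; first by apply/nbhsCP; exists 1.
  exists (1 + normc z); first by rewrite ltr_pwDl // normc_ge0.
  move=> w /= wz; rewrite -ltrBlDr; apply: le_lt_trans wz; exact: ler_normcB.
Qed.

Lemma hausdorffC : hausdorff_space C.
Proof. exact: norm_hausdorff. Qed.

(** Normality is transported from [R * R] along the homeomorphism [h] with inverse [g]. *)
Lemma closed_sepC A B : closed A -> closed B -> A `&` B = set0 ->
  exists U V, [/\ open U, open V, A `<=` U, B `<=` V & U `&` V = set0].
Proof.
move=> cA cB AB0.
pose h (p : R * R) : C := p.1 +i* p.2.
have hc : continuous h.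
  by move=> p; apply: cvg_complex; [exact: cvg_fst|exact: cvg_snd].
pose g z := (Re z, Im z).
have gc : continuous g.
  by move=> z; exact: (cvg_pair (@continuous_Re z) (@continuous_Im z)).
have hK z : h (g z) = z by case: z.
have /(@normal_openP R) := @pseudometric_normal R (R * R)%type.
move=> /(_ (h @^-1` A) (h @^-1` B))[].
- by apply: closed_comp => // ? _; exact: hc.
- by apply: closed_comp => // ? _; exact: hc.
- by rewrite -preimage_setI AB0 preimage_set0.
move=> U [V [oU oV AU BV UV0]]; exists (g @^-1` U), (g @^-1` V); split.
- by apply: open_comp => // ? _; exact: gc.
- by apply: open_comp => // ? _; exact: gc.
- by move=> z Az; apply: AU; rewrite /= hK.
- by move=> z Bz; apply: BV; rewrite /= hK.
- by rewrite -preimage_setI UV0 preimage_set0.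
Qed.

Lemma normal_spaceC : normal_space C.
Proof. by apply/(@normal_openP R); exact: closed_sepC. Qed.

End complex_topology.

Arguments hausdorffC : clear implicits.

(** * Continua of bounded orbits *)

Section bounded_orbits.
Variable R : realType.
Local Notation C := R[i].
Variables (f : C -> C) (D : nat -> set C).
Hypothesis f_continuous : continuous f.
Hypothesis D_open : forall n, open (D n).
Hypothesis D_bounded : forall n, exists r : R, forall z, D n z -> normc z <= r.
Hypothesis D_step : forall n z, closure (D n) z -> ~ D n z -> ~ D n.+1 (f z).
Hypothesis D_exhausts : forall r : R, exists N, forall n, (N <= n)%N ->
  [set z | normc z <= r] `<=` D n.

(** Time 0 is included, unlike in [unbounded_orbit_set]; this does not affect which orbits are
    bounded. *)
Definition orbit_le (m : R) : set C := [set z | forall n, normc (iter n f z) <= m].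

Definition orbit_bounded (L : set C) := exists m, L `<=` orbit_le m.

Lemma iter_continuous n : continuous (iter n f).
Proof.
elim: n => [|n IH] z; first exact: cvg_id.
by apply: continuous_comp; [exact: IH|exact: f_continuous].
Qed.

Lemma orbit_le_closed m : closed (orbit_le m).
Proof.
rewrite (_ : orbit_le m = \bigcap_n ((@normc R \o iter n f) @^-1` [set x | x <= m])).
  apply: closed_bigI => n _; apply: closed_comp; last exact: closed_le.
  move=> z _; apply: continuous_comp; first exact: iter_continuous.
  exact: continuous_normc.
by apply/seteqP; split => z /= h n; [move=> _|]; exact: h.
Qed.

Lemma orbit_le_mono m m' : m <= m' -> orbit_le m `<=` orbit_le m'.
Proof. by move=> mm' z h n; exact: le_trans (h n) mm'. Qed.

(* Once [f^n(L)] leaves [D M] it also leaves [D (M + k)] at time [n + k] for all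
   [k], because the boundary points in between are mapped outside. *)
Lemma orbit_le_connected m : exists rho, forall L, connected L ->
  orbit_bounded L -> L `&` orbit_le m !=set0 -> L `<=` orbit_le rho.
Proof.
have [M MP] := D_exhausts m; have [rho rhoP] := D_bounded M.
exists rho => L Lc [m' Lm'] [w [Lw wm]] z Lz n; apply: rhoP.
apply: contrapT => nDz.
have key k : exists2 y, L y & ~ D (M + k)%N (iter (n + k) f y).
  elim: k => [|k [y Ly nDy]]; first by exists z => //; rewrite !addn0.
  have [||||u [Lu [clu nDu]]] := @connected_meets_frontier _ (iter (n + k) f @` L) (D (M + k)%N).
  - apply: (connected_continuous_connected Lc).
    by apply: continuous_subspaceT; exact: iter_continuous.
  - exact: D_open.
  - exists (iter (n + k) f w); split; first by exists w.
    by apply: (MP _ (leq_addr _ _)); exact: wm.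
  - by move=> h; apply: nDy; apply: h; exists y.
  case: Lu clu nDu => v Lv <- clv nDv; exists v => //.
  by rewrite !addnS iterS; exact: D_step.
have [N NP] := D_exhausts m'.
have [y Ly] := key N; apply; apply: (NP _ (leq_addl _ _)) => /=.
exact: Lm'.
Qed.

(** Take [z] in [K] whose orbit leaves the disc of radius [Num.max m rho]. If all subcontinua of [K]
    avoiding [orbit_le m] had uniformly bounded orbits, so would the closure of the union of those
    through [z]. By boundary bumping that closure meets [orbit_le m], which forces the orbit of [z]
    into the disc of radius [rho]. *)
Lemma unbounded_subcontinuum K m : compact K -> connected K ->
  (forall z, K z -> exists m', orbit_le m' z) -> ~ orbit_bounded K ->
  exists L, [/\ compact L, connected L, L `<=` K, ~ orbit_bounded L &
    L `&` orbit_le m = set0].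
Proof.
move=> cptK Kc Kb nKb.
have [rho rhoP] := orbit_le_connected m.
have [Km|/set0P Km] := eqVneq (K `&` orbit_le m) set0; first by exists K; split.
have [z Kz nz] : exists2 z, K z & ~ orbit_le (Num.max m rho) z.
  apply: contrapT => h; apply: nKb; exists (Num.max m rho) => z Kz.
  by apply: contrapT => nz; apply: h; exists z.
apply: contrapT => H.
have nmz : ~ orbit_le m z by move=> zm; apply: nz; apply: (orbit_le_mono _ zm); rewrite le_max lexx.
have [m' zm'] := Kb _ Kz.
have [rho' rho'P] := orbit_le_connected m'.
pose S := subcontinua K (orbit_le m) z.
(* One radius [rho'] serves all these continua, because they share the point [z]. *)
have Sr : S `<=` orbit_le rho'.
  move=> y [L [cptL Lc LK Lz Lm] Ly].
  apply: (rho'P L) => //; last by exists z.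
  by apply: contrapT => nLb; apply: H; exists L; split.
have clSr : closure S `<=` orbit_le rho'.
  by move=> y /(closureS Sr); rewrite -(closure_id _).1 //; exact: orbit_le_closed.
have Sz : S z.
  exists [set z] => //; split => //.
  - exact: compact_set1.
  - exact: connected1.
  - by move=> _ ->.
  - by rewrite -subset0 => y [->].
apply: nz; apply: (@orbit_le_mono rho); first by rewrite le_max lexx orbT.
apply: (rhoP (closure S)).
- by apply: connected_closure; exact: subcontinua_connected.
- by exists rho'.
- apply: (subcontinua_closure_meets (hausdorffC R) (@closed_sepC R)) => //.
  exact: orbit_le_closed.
- exact: subset_closure.
Qed.

Lemma continuum_orbit_bounded K : compact K -> connected K ->
  (forall z, K z -> exists m, orbit_le m z) -> orbit_bounded K.
Proof.
move=> cptK Kc Kb; apply: contrapT => nKb.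
pose good L := [/\ compact L, connected L, L `<=` K & ~ orbit_bounded L].
(* With the implication under the existential the claim holds for every pair, so the axiom of choice
   applies. *)
have step (p : set C * nat) : exists L', good p.1 ->
    [/\ good L', L' `<=` p.1 & L' `&` orbit_le p.2%:R = set0].
  have [[cptL Lc LK nLb]|ng] := pselect (good p.1); last by exists set0.
  have [//|L' [cptL' L'c L'L nL'b L'm]] := unbounded_subcontinuum (p.2%:R) cptL Lc _ nLb.
    by move=> z /LK; exact: Kb.
  by exists L' => _; split => //; split => // z /L'L /LK.
have [g gP] := choice step.
pose L := fix L n := if n is n'.+1 then g (L n', n') else K.
have Lgood n : good (L n).
  by elim: n => [|n IH]; [split|have [] := gP (L n, n) IH].
have [x Lx] : \bigcap_n L n !=set0.
  apply: (nested_compact_nonempty (hausdorffC R)).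
  - by move=> n; case: (Lgood n).
  - move=> n; apply/set0P/eqP => L0; case: (Lgood n) => _ _ _; apply.
    by exists 0; rewrite L0.
  - by move=> n; have [] := gP (L n, n) (Lgood n).
have [m xm] := Kb x (Lx 0%N I).
(* The common point [x] lies in [L k.+1], which avoids [orbit_le k%:R], although [m] is below
   [k%:R]. *)
pose k := Num.bound m.
have [_ _ h] := gP (L k, k) (Lgood k).
have : (g (L k, k) `&` orbit_le k%:R) x.
  split; first exact: (Lx k.+1 I).
  apply: (orbit_le_mono _ xm); apply: ltW; apply: archi_boundP.
  exact: le_trans (normc_ge0 _) (xm 0%N).
by rewrite h.
Qed.

End bounded_orbits.

(** * Continuous arguments *)

Section angles.
Variable R : realType.
Local Notation C := R[i].
Local Notation Re := (@complex.Re R).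
Local Notation Im := (@complex.Im R).
Implicit Types (z w : C) (S : set C) (g h : C -> C).

Definition expi (t : R) : C := cos t +i* sin t.

Lemma expiD s t : expi (s + t) = expi s * expi t.
Proof. by rewrite /expi cosD sinD; apply/eqP; rewrite eq_complex /= [sin s * _ + _]addrC !eqxx. Qed.

Lemma expi0 : expi 0 = 1.
Proof. by rewrite /expi cos0 sin0. Qed.

Lemma expiN t : expi (- t) = (expi t)^-1.
Proof.
have e : expi (- t) * expi t = 1 by rewrite -expiD addNr expi0.
have u : expi t \is a GRing.unit by rewrite unitfE; apply/eqP => h; move/eqP: e; rewrite h mulr0 eq_sym oner_eq0.
by rewrite -[LHS](mulrK u) e mul1r.
Qed.

Lemma normc_expi t : normc (expi t) = 1.
Proof. by rewrite /expi /= cos2Dsin2 sqrtr1. Qed.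

Lemma continuous_expi : continuous expi.
Proof. by move=> t; apply: cvg_complex; [exact: continuous_cos|exact: continuous_sin]. Qed.

(* [theta] is required to be bounded so that Tietze's theorem applies to it. *)
Definition has_angle S h := exists theta : C -> R,
  [/\ {within S, continuous theta}, exists M, forall z, S z -> `|theta z| <= M &
      forall z, S z -> h z = (normc (h z))%:C * expi (theta z)].

Lemma has_angle_sub S S' h : S' `<=` S -> has_angle S h -> has_angle S' h.
Proof.
move=> SS' [t [tc [M tM] th]]; exists t; split.
- exact: continuous_subspaceW tc.
- by exists M => z /SS'; exact: tM.
- by move=> z /SS'; exact: th.
Qed.

Lemma has_angle_ext S g h : (forall z, S z -> g z = h z) -> has_angle S g -> has_angle S h.
Proof.
move=> gh [t [tc tM th]]; exists t; split => // z Sz.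
by rewrite -gh //; exact: th.
Qed.

Lemma within_continuousD S (a b : C -> R) : {within S, continuous a} -> {within S, continuous b} ->
  {within S, continuous (fun z => a z + b z)}.
Proof. by move=> ac bc z; apply: cvgD; [exact: ac|exact: bc]. Qed.

Lemma has_angleM S g h : has_angle S g -> has_angle S h ->
  has_angle S (fun z => g z * h z).
Proof.
move=> [t [tc [M tM] th]] [u [uc [N uN] uh]]; exists (fun z => t z + u z); split.
- exact: within_continuousD.
- exists (M + N) => z Sz; apply: le_trans (ler_normD _ _) _; apply: lerD; [exact: tM|exact: uN].
- move=> z Sz; rewrite {1}th // {1}uh // expiD normcM rmorphM /=.
  by rewrite mulrACA.
Qed.

Lemma has_angleV S h : has_angle S h -> has_angle S (fun z => (h z)^-1).
Proof.
move=> [t [tc [M tM] th]]; exists (fun z => - t z); split.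
- by move=> z; apply: cvgN; exact: tc.
- by exists M => z Sz; rewrite normrN; exact: tM.
- by move=> z Sz; rewrite {1}th // expiN normcV invfM fmorphV.
Qed.

Lemma has_angle_cst S (t : R) : has_angle S (fun=> expi t).
Proof.
exists (fun=> t); split.
- by apply: continuous_subspaceT; exact: cst_continuous.
- by exists `|t|.
- by move=> z _; rewrite normc_expi mul1r.
Qed.

Lemma right_half_plane_angle z : 0 < Re z ->
  z = (normc z)%:C * expi (atan (Im z / Re z)).
Proof.
case: z => a b /= a0; rewrite /expi.
have ca : cos (atan (b / a)) != 0 by rewrite cos_atan invr_eq0 gt_eqF // sqrtr_gt0 ltr_pwDl // sqr_ge0.
have sE : sin (atan (b / a)) = (b / a) * cos (atan (b / a)).
  by have := atanK (b / a); rewrite /tan => {2}<-; rewrite divfK.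
have nE : Num.sqrt (a ^+ 2 + b ^+ 2) * cos (atan (b / a)) = a.
  rewrite cos_atan -[X in _ / Num.sqrt X](_ : (a ^+ 2 + b ^+ 2) / a ^+ 2 = _); last first.
    by field; rewrite gt_eqF.
  rewrite sqrtrM ?addr_ge0 ?sqr_ge0 // sqrtrV ?sqr_ge0 // sqrtr_sqr gtr0_norm //.
  rewrite invfM invrK mulrA divff ?mul1r //.
  by rewrite gt_eqF // sqrtr_gt0 ltr_pwDl ?sqr_ge0 // exprn_gt0.
apply/eqP; rewrite eq_complex /= !mul0r subr0 addr0 sE mulrCA nE eqxx /=.
by rewrite divfK // gt_eqF.
Qed.

(** The principal argument is an arctangent on the right half-plane, continuous and bounded by
    [pi / 2]. *)
Lemma has_angle_right_half_plane S h : {within S, continuous h} ->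
  (forall z, S z -> 0 < Re (h z)) -> has_angle S h.
Proof.
move=> /subspace_continuousP hc h0; exists (fun z => atan (Im (h z) / Re (h z))); split.
- apply/subspace_continuousP => z Sz.
  apply: (@continuous_cvg _ _ _ (within S (nbhs z)) _ (fun w => Im (h w) / Re (h w)) atan).
    exact: continuous_atan.
  apply: cvgM.
    by apply: (@continuous_cvg _ _ _ (within S (nbhs z))); [exact: continuous_Im|exact: hc].
  apply: cvgV; first by rewrite gt_eqF // h0.
  by apply: (@continuous_cvg _ _ _ (within S (nbhs z))); [exact: continuous_Re|exact: hc].
- by exists (pi / 2) => z _; rewrite ler_norml !ltW // ?atan_gtNpi2 ?atan_ltpi2.
- by move=> z Sz; apply: right_half_plane_angle; exact: h0.
Qed.

Lemma Re_gt0_near1 z : normc (z - 1) < 1 -> 0 < Re z.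
Proof.
move=> h; have := le_lt_trans (ler_Re_normc _) h.
by case: z {h} => a b /=; rewrite ltr_norml => /andP[+ _]; rewrite ltrBrDr addNr.
Qed.

(** Off the imaginary axis, [z] or its opposite lies in the right half-plane; a nonzero imaginary
    [z] is first rotated by ['i]. *)
Lemma polar z : exists t, z = (normc z)%:C * expi t.
Proof.
have pN w : (exists t, - w = (normc (- w))%:C * expi t) -> exists t, w = (normc w)%:C * expi t.
  move=> [t tE]; exists (t + pi); rewrite expiD.
  have -> : expi pi = -1 by rewrite /expi cospi sinpi; apply/eqP; rewrite eq_complex /= oppr0 !eqxx.
  by rewrite mulrN1 mulrN -(normc_opp w) -tE opprK.
have H w : Re w != 0 -> exists t, w = (normc w)%:C * expi t.
  move=> w0; have [w1|w1|w1] := ltgtP (Re w) 0.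
  - apply: pN; exists (atan (Im (- w) / Re (- w))); apply: right_half_plane_angle.
    by case: w w1 {w0} => a b /=; rewrite oppr_gt0.
  - by exists (atan (Im w / Re w)); exact: right_half_plane_angle.
  - by rewrite w1 eqxx in w0.
have [z0|z0] := eqVneq (Re z) 0; last exact: H.
have [z1|z1] := eqVneq (Im z) 0.
  exists 0; have -> : z = 0 by apply/eqP; rewrite eq_complex /= z0 z1 eqxx.
  by rewrite normc0 mul0r.
have [|t tE] := H (z * 'i); first by rewrite ReiNIm oppr_eq0.
exists (t + - (pi / 2)); rewrite expiD expiN.
have iE : expi (pi / 2) = 'i by rewrite /expi cos_pihalf sin_pihalf.
have i0 : 'i%C != 0 :> C by rewrite eq_complex /= oner_eq0 andbF.
have ni : normc 'i = 1 :> R by rewrite -iE normc_expi.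
by rewrite mulrA iE -[RHS]/((normc z)%:C * expi t / 'i) -[normc z]mulr1 -ni -normcM -tE mulfK.
Qed.

(** Near a point of one of the sets the other one is absent, so the glued angle is continuous
    there. *)
Lemma has_angle_setU S S' h : closed S -> closed S' -> S `&` S' = set0 ->
  has_angle S h -> has_angle S' h -> has_angle (S `|` S') h.
Proof.
move=> cS cS' SS' [t [/subspace_continuousP tc [M tM] th]] [u [/subspace_continuousP uc [N uN] uh]].
pose v z := if z \in S then t z else u z.
have vS z : S z -> v z = t z by move=> Sz; rewrite /v mem_set.
have vS' z : S' z -> v z = u z.
  by move=> S'z; rewrite /v memNset // => Sz; have : (S `&` S') z by []; rewrite SS'.
have key (A B : set C) (a : C -> R) z : closed B -> A z -> ~ B z -> (forall w, A w -> v w = a w) ->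
    a @ within A (nbhs z) --> a z -> v @ within (A `|` B) (nbhs z) --> v z.
  move=> cB Az nBz va ac; rewrite va //.
  have F := ac; move=> P /F; rewrite /nbhs /= /fmap /within /=.
  have nB : \forall w \near z, ~ B w by apply: (open_nbhs_nbhs (conj (closed_openC cB) _)).
  move=> aP; near=> w => -[Aw|Bw].
    have /= aPw : A w -> P (a w) by near: w.
    by rewrite /= va //; exact: aPw.
  by have : ~ B w by near: w.
exists v; split.
- apply/subspace_continuousP => z [Sz|S'z].
    apply: (key S S' t) => //; last exact: tc.
    by move=> S'z; have : (S `&` S') z by []; rewrite SS'.
  rewrite setUC; apply: (key S' S u) => //; last exact: uc.
  by move=> Sz; have : (S `&` S') z by []; rewrite SS'.
- exists (Num.max M N) => z [Sz|S'z]; rewrite le_max.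
    by rewrite vS // tM.
  by rewrite vS' // uN // orbT.
- by move=> z [Sz|S'z]; [rewrite vS //; exact: th|rewrite vS' //; exact: uh].
Unshelve. all: by end_near. Qed.

End angles.

(** * Angles on discs and circles *)

Section winding.
Variable R : realType.
Local Notation C := R[i].
Local Notation Re := (@complex.Re R).
Local Notation Im := (@complex.Im R).
Implicit Types (z w : C) (S : set C) (g h : C -> C).

Lemma continuous_toC : continuous (fun x : R => x%:C : C).
Proof. by move=> x; apply: cvg_complex; [exact: cvg_id|exact: cvg_cst]. Qed.

Lemma continuous_subC w : continuous (fun z : C => z - w).
Proof. by move=> z; exact: (cvgB cvg_id (cvg_cst w)). Qed.

Lemma Re_div_gt0 z w : normc (z - w) < normc w -> 0 < Re (z / w).
Proof.
move=> zw; have w0 : 0 < normc w by apply: le_lt_trans zw; exact: normc_ge0.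
have w0' : w != 0 by rewrite -normc_gt0.
apply: Re_gt0_near1; rewrite -[1](divff w0') -mulrBl normcM normcV.
by rewrite ltr_pdivrMr // mul1r.
Qed.

Lemma connected_locally_constant (T : topologicalType) (P : T -> Prop) (x y : T) :
  connected [set: T] -> (forall a : T, \forall b \near a, P b <-> P a) -> P x -> P y.
Proof.
move=> Tc Ploc Px.
suff /seteqP[_] : [set a | P a] = setT by apply.
apply: Tc; first by exists x.
- exists [set a | P a]; last by rewrite setTI.
  by rewrite openE => a Pa; have := Ploc a; apply: filterS => b /= [_]; apply.
- exists [set a | P a]; last by rewrite setTI.
  rewrite -openC openE => a nPa; have := Ploc a.
  by apply: filterS => b /= [] h _ /h.
Qed.

Lemma connectedR : connected [set: R].
Proof.
apply/connected_intervalP => x y _ _ z _; exact: I.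
Qed.

(* Contracting the disc to its centre changes the angle of [h] continuously. *)
Lemma has_angle_disc h (c : C) (r : R) : continuous h -> (forall z, h z != 0) ->
  has_angle [set z | normc (z - c) <= r] h.
Proof.
move=> hc h0; set B := [set z | _].
have cB : compact B.
  apply: compactC.
    exists (r + normc c) => z zr; rewrite -lerBlDr; apply: le_trans zr; exact: ler_normcB.
  rewrite (_ : B = (fun z => normc (z - c)) @^-1` [set x | x <= r]) //.
  apply: closed_comp; last exact: closed_le.
  move=> z _; apply: (@continuous_comp _ _ _ (fun z => z - c)); last exact: continuous_normc.
  exact: continuous_subC.
pose H (t : R) z := h (c + t%:C * (z - c)).
have Hc : continuous (fun p : C * R => H p.2 p.1).
  move=> p; apply: (@continuous_comp _ _ _ (fun p : C * R => c + p.2%:C * (p.1 - c))); last exact: hc.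
  apply: cvgD; first exact: cvg_cst.
  apply: cvgM.
    apply: (@continuous_cvg _ _ _ (nbhs p) _ snd (fun x : R => x%:C : C)); [exact: continuous_toC|exact: cvg_snd].
  by apply: cvgB; [exact: cvg_fst|exact: cvg_cst].
(* By compactness of the disc, the estimate that puts [H s z / H t z] in the right half-plane holds
   for all [z] at once when [s] is near [t]. *)
have near_t t : \forall s \near t, forall z, B z -> normc (H s z - H t z) < normc (H t z).
  have /compact_near_coveringP cvB := cB.
  apply: (cvB _ (nbhs t) (fun s z => normc (H s z - H t z) < normc (H t z))) => z Bz.
  pose k (p : C * R) := normc (H p.2 p.1 - H t p.1) - normc (H t p.1).
  have kc : continuous k.
    have Htc : continuous (fun p : C * R => H t p.1).
      move=> p; apply: (@continuous_comp _ _ _ (fun p : C * R => (p.1, t)) (fun p : C * R => H p.2 p.1)); last exact: Hc.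
      exact: (cvg_pair cvg_fst (cvg_cst t)).
    move=> p.
    have n1 : normc (H q.2 q.1 - H t q.1) @[q --> p] --> normc (H p.2 p.1 - H t p.1).
      exact: (continuous_cvg _ (@continuous_normc R _) (cvgB (Hc p) (Htc p))).
    have n2 : normc (H t q.1) @[q --> p] --> normc (H t p.1).
      exact: (continuous_cvg _ (@continuous_normc R _) (Htc p)).
    exact: (cvgB n1 n2).
  have : k (z, t) < 0 by rewrite /k /= subrr normc0 sub0r oppr_lt0 normc_gt0 h0.
  move=> kzt; have : \forall p \near (z, t), k p < 0.
    exact: (kc (z, t) _ (open_nbhs_nbhs (conj (@open_lt R 0) kzt))).
  by apply: filterS => p; rewrite /k subr_lt0.
have step s t : (forall z, B z -> normc (H s z - H t z) < normc (H t z)) ->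
    has_angle B (fun z => H s z / H t z).
  move=> st; apply: has_angle_right_half_plane; last by move=> z /st; exact: Re_div_gt0.
  have Hsc u : continuous (H u).
    move=> z; apply: (@continuous_comp _ _ _ (fun z : C => (z, u)) (fun p : C * R => H p.2 p.1)); last exact: Hc.
    exact: (@cvg_pair _ _ _ (nbhs z) (nbhs z) (nbhs u) _ _ _ id (fun=> u) cvg_id (cvg_cst u)).
  apply: continuous_subspaceT => z.
  exact: (cvgM (Hsc s z) (cvgV (h0 _) (Hsc t z))).
have H0 : has_angle B (H 0).
  have [t tE] := polar (h c); have := has_angle_cst B t.
  move=> [u [uc uM uE]]; exists u; split => // z Bz.
  have -> : H 0 z = h c by rewrite /H mul0r addr0.
  by rewrite [LHS]tE [X in _ * X](uE z Bz) normc_expi mul1r.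
suff : has_angle B (H 1).
  by apply: has_angle_ext => z _; rewrite /H mul1r addrC subrK.
(* Whether [H t] has an angle is locally constant in [t], since [H s] and [H t] differ by a factor
   with an angle. *)
apply: (connected_locally_constant (P := fun t => has_angle B (H t))) H0; first exact: connectedR.
move=> t; have := near_t t; apply: filterS => s /step st; split=> a.
  have := has_angleM (has_angleV st) a; apply: has_angle_ext => z Bz.
  by rewrite invf_div divfK // h0.
have := has_angleM st a; apply: has_angle_ext => z Bz.
by rewrite divfK // h0.
Qed.

(* The difference of the angles at antipodal points is an odd function on the
   circle, so it vanishes somewhere, which is absurd. *)
Lemma circle_no_angle (c : C) (r : R) : 0 < r ->
  ~ has_angle [set z | normc (z - c) = r] (fun z => z - c).
Proof.
move=> r0 [u [uc _ uE]]; set S := [set z | _] in uc uE.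
pose p (t : R) := c + r%:C * expi t.
pose q (t : R) := c - r%:C * expi t.
have nr t : normc (r%:C * expi t) = r.
  by rewrite normcM normc_real normc_expi mulr1 gtr0_norm.
have Sp t : S (p t) by rewrite /S /= /p addrC addKr nr.
have Sq t : S (q t) by rewrite /S /= /q addrC addKr normc_opp nr.
have comp (m : R -> C) : continuous m -> (forall t, S (m t)) -> continuous (u \o m).
  move=> mc Sm t; move/subspace_continuousP : uc => /(_ _ (Sm t)) uc.
  apply: cvg_comp uc => P /(mc t) mP.
  exact: (filterS (fun s (h : S (m s) -> P (m s)) => h (Sm s)) mP).
have ec : continuous (fun t : R => r%:C * expi t).
  by move=> t; exact: (cvgM (cvg_cst r%:C) (@continuous_expi R t)).
have pc : continuous p by move=> t; exact: (cvgD (cvg_cst c) (ec t)).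
have qc : continuous q by move=> t; exact: (cvgB (cvg_cst c) (ec t)).
pose psi t := u (q t) - u (p t).
have psic : continuous psi.
  by move=> t; exact: (cvgB (comp _ qc Sq t) (comp _ pc Sp t)).
have pi0 : 0 <= pi :> R by exact: pi_ge0.
have epi : expi (pi : R) = -1.
  by rewrite /expi cospi sinpi; apply/eqP; rewrite eq_complex /= oppr0 !eqxx.
have psi_pi : psi pi = - psi 0.
  by rewrite /psi /p /q epi expi0 !mulrN mulr1 opprK opprB.
have [t _ psit] : exists2 t, t \in `[0, pi] & psi t = 0.
  apply: IVT => //; first exact: continuous_subspaceT.
  by rewrite psi_pi ge_min le_max; case: (leP 0 (psi 0)) => [|/ltW] h; rewrite ?oppr_le0 ?oppr_ge0 h ?orbT.
(* At this [t] the antipodal points have the same modulus and the same angle about [c], so they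
   coincide, against [0 < r]. *)
have := uE _ (Sp t); have := uE _ (Sq t).
have -> : u (q t) = u (p t) by apply/eqP; rewrite -subr_eq0; apply/eqP.
rewrite (Sp t) (Sq t) => <-; rewrite /p /q ![c + _]addrC !addrK => /eqP.
rewrite -subr_eq0 opprK -mulr2n mulrn_eq0 /= => /eqP h.
by have := nr t; rewrite h normc0 => h0; rewrite -h0 ltxx in r0.
Qed.

End winding.

(** * Continuous arguments and separation of the plane *)

Section separation.
Variable R : realType.
Local Notation C := R[i].
Implicit Types (z w c : C) (K S X U : set C) (g h : C -> C).

Lemma continuous_dist w : continuous (fun z : C => normc (z - w)).
Proof.
move=> z; apply: (@continuous_comp _ _ _ (fun z => z - w)).
  exact: continuous_subC.
exact: continuous_normc.
Qed.

Lemma has_angle_const S c : has_angle S (fun=> c).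
Proof.
have [t tE] := polar c; have [u [uc uM uE]] := has_angle_cst S t.
exists u; split => // z Sz.
by rewrite [LHS]tE [X in _ * X](uE z Sz) normc_expi mul1r.
Qed.

Lemma has_angle_div S (h k : C -> C) : continuous h -> continuous k ->
  (forall z, S z -> normc (h z - k z) < normc (k z)) ->
  has_angle S (fun z => h z / k z).
Proof.
move=> hc kc hk; apply: has_angle_right_half_plane; last first.
  by move=> z /hk; exact: Re_div_gt0.
apply: continuous_in_subspaceT => z /set_mem Sz.
have kz : k z != 0 by rewrite -normc_gt0; apply: le_lt_trans (hk z Sz); exact: normc_ge0.
exact: (cvgM (hc z) (cvgV kz (kc z))).
Qed.

(** The quotient [(z - w') / (z - w)] stays at distance less than 1 from 1, so it has an angle. *)
Lemma has_angle_transfer S w w' : (forall z, S z -> normc (w - w') < normc (z - w)) ->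
  has_angle S (fun z => z - w') <-> has_angle S (fun z => z - w).
Proof.
move=> Sw.
have q : has_angle S (fun z => (z - w') / (z - w)).
  apply: has_angle_div; [exact: continuous_subC|exact: continuous_subC|].
  move=> z /Sw; rewrite (_ : z - w' - (z - w) = w - w') //; by ring.
have w0 z : S z -> z - w != 0 by move=> /Sw h; rewrite -normc_gt0; apply: le_lt_trans h; exact: normc_ge0.
have w'0 z : S z -> z - w' != 0.
  move=> /Sw h; apply/eqP => /eqP; rewrite subr_eq0 => /eqP zw'.
  by rewrite -zw' normc_distC ltxx in h.
split=> a.
  apply: has_angle_ext (has_angleM a (has_angleV q)) => z Sz.
  by rewrite invf_div mulrC divfK // w'0.
apply: has_angle_ext (has_angleM q a) => z Sz.
by rewrite divfK // w0.
Qed.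

(** The angle is required on a neighbourhood of [K], so that it can be restricted to clopen parts
    slightly larger than a component [K]. *)
Definition angle_near K w := exists O, [/\ open O, K `<=` O & has_angle O (fun z => z - w)].

Lemma angle_near_loc K w : closed K -> ~ K w ->
  \forall w' \near w, angle_near K w' <-> angle_near K w.
Proof.
move=> cK nKw.
have /nbhsCP[e e0 eP] : nbhs w (~` K).
  by apply: open_nbhs_nbhs; split => //; exact: closed_openC.
have e20 : 0 < e / 2 by rewrite divr_gt0.
(* Points of [O'] are so far from [w] that moving [w] by less than [e / 2] preserves the existence
   of an angle. *)
pose O' := [set z | e / 2 < normc (z - w)].
have oO' : open O'.
  rewrite (_ : O' = (fun z => normc (z - w)) @^-1` [set x | e / 2 < x]) //.
  by apply: open_comp; [move=> z _; exact: continuous_dist|exact: open_gt].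
have KO' : K `<=` O'.
  move=> z Kz; rewrite /O' /= ltNge; apply/negP => h; apply: (eP z) Kz.
  by apply: le_lt_trans h _; rewrite ltr_pdivrMr // ltr_pMr // ltr1n.
apply/nbhsCP; exists (e / 2) => // w' w'w.
have tr S : S `<=` O' -> has_angle S (fun z => z - w') <-> has_angle S (fun z => z - w).
  move=> SO; apply: has_angle_transfer => z /SO; rewrite /O' /=; apply: lt_trans.
  by rewrite normc_distC.
split; case=> O [oO KO aO]; exists (O `&` O'); split.
- exact: openI.
- by move=> z Kz; split; [exact: KO|exact: KO'].
- by apply/tr; [move=> z []|apply: has_angle_sub aO => z []].
- exact: openI.
- by move=> z Kz; split; [exact: KO|exact: KO'].
- by apply/tr; [move=> z []|apply: has_angle_sub aO => z []].
Qed.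

Lemma angle_near_far K r w : (forall z, K z -> normc z < r) -> r <= normc w ->
  angle_near K w.
Proof.
move=> Kr rw; exists [set z | normc z < r]; split => //.
  rewrite (_ : [set z | _] = @normc R @^-1` [set x | x < r]) //.
  by apply: open_comp; [move=> z _; exact: continuous_normc|exact: open_lt].
(* If [w = 0], then [r <= 0] and the disc is empty; otherwise [(z - w) / (- w)] is close enough to 1
   on the disc. *)
have [w0|w0] := eqVneq w 0.
  apply: (@has_angle_sub _ set0); first by move=> z /= zr; have := lt_le_trans zr rw; rewrite w0 normc0 ltNge normc_ge0.
  exists (fun=> 0); split => //; first by apply: continuous_subspaceT; exact: cst_continuous.
  by exists 0.
have a : has_angle [set z | normc z < r] (fun z => (z - w) / (- w)).
  apply: has_angle_div; [exact: continuous_subC|exact: cst_continuous|].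
  by move=> z zr; rewrite opprK subrK normc_opp; apply: lt_le_trans rw.
apply: has_angle_ext (has_angleM a (has_angle_const _ (- w))) => z _.
by rewrite divfK // oppr_eq0.
Qed.

(* The points [w] outside [K] for which [z - w] has an angle near [K] form an open
   and closed subset of the complement, which contains all points far away. *)
Lemma no_angle_hole K w : compact K -> ~ K w -> ~ angle_near K w ->
  exists G, [/\ open G, G w, exists r : R, forall z, G z -> normc z <= r &
    closure G `\` G `<=` K].
Proof.
move=> cptK nKw naw.
have cK : closed K by apply: compact_closed; [exact: hausdorffC|].
have [r r0 Kr] := compactC_bounded cptK.
pose G := [set z | ~ K z /\ ~ angle_near K z].
exists G; split => //.
- rewrite openE => z [nKz naz]; rewrite /interior /=.
  have := angle_near_loc cK nKz; have : nbhs z (~` K).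
    by apply: open_nbhs_nbhs; split => //; exact: closed_openC.
  by apply: filterS2 => w' nK' [h _]; split => // /h.
- exists r => z [_ naz]; rewrite leNgt; apply/negP => /ltW h; apply: naz.
  exact: angle_near_far h.
- move=> z [clz nGz]; apply: contrapT => nKz.
  have [w' [[nKw' naw'] [_ h]]] := clz _ (angle_near_loc cK nKz).
  by apply: nGz; split => // /h.
Qed.

Lemma continuous_normalize z : z != 0 -> {for z, continuous (fun w : C => w / (normc w)%:C)}.
Proof.
move=> z0; have n0 : (normc z)%:C != 0 :> C.
  by rewrite -normc_eq0 in z0; apply: contra z0 => /eqP/complexI ->.
have n1 : (normc w)%:C @[w --> z] --> ((normc z)%:C : C).
  exact: (continuous_cvg _ (@continuous_toC R _) (@continuous_normc R z)).
have n2 : ((normc w)%:C^-1 : C) @[w --> z] --> ((normc z)%:C^-1 : C) by exact: (cvgV n0 n1).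
have n4 := @cvgM C _ (nbhs z) _ (fun w => w) _ z _ (@cvg_id _ _) n2.
exact: n4.
Qed.

(** The set [U] is arbitrary: both branches tend to the same value at [z]. *)
Lemma continuous_if U (F G : C -> C) z : F z = G z ->
  {for z, continuous F} -> {for z, continuous G} ->
  {for z, continuous (fun w => if w \in U then F w else G w)}.
Proof.
move=> FG Fc Gc P; rewrite /= (_ : (if z \in U then F z else G z) = G z); last by case: ifP.
move=> GP; have FP : nbhs (F z) P by rewrite FG.
have H w : P (G w) -> P (F w) -> P (if w \in U then F w else G w) by case: ifP.
have GP' : \forall w \near z, P (G w) by exact: (Gc _ GP).
have FP' : \forall w \near z, P (F w) by exact: (Fc _ FP).
have Q : \forall w \near z, P (if w \in U then F w else G w) by exact: filterS2 H GP' FP'.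
exact: Q.
Qed.

(** An angle of the quotient on [X'] extends to an angle on all of [X] and far away, then by Tietze
    to a real function [T] on the plane. It allows the directions of [z - w2], turned by [T], on
    [U1] and of [z - w1] elsewhere to be glued into a continuous map without zeros. That map has an
    angle on every disc, so [z - w2] would have one on a large circle around [w2]. *)
Lemma separated_no_angle U1 U2 w1 w2 X' : open U1 -> open U2 ->
  U1 `&` U2 = set0 -> U1 w1 -> U2 w2 ->
  X' `<=` ~` (U1 `|` U2) -> closed X' -> closed (~` (U1 `|` U2) `\` X') ->
  (exists r : R, forall z, X' z -> normc z < r) ->
  (forall z, ~ U1 z -> ~ U2 z -> normc z <= normc w1 + normc w2 + normc w2 -> X' z) ->
  ~ has_angle X' (fun z => (z - w1) / (z - w2)).
Proof.
move=> oU1 oU2 U12 U1w1 U2w2 X'X cX' cX'' [r' X'r'] X'near aX'.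
set r1 := normc w1 + normc w2 + normc w2 in X'near.
set X := ~` (U1 `|` U2) in X'X cX''.
pose r2 := Num.max (r1 + 1) r'.
have r12 : r1 < r2 by rewrite lt_max ltrDl ltr01.
have X'r2 z : X' z -> normc z < r2 by move=> /X'r' h; rewrite lt_max h orbT.
have r10 : 0 <= r1 by rewrite !addr_ge0 ?normc_ge0.
pose far := [set z : C | r2 <= normc z].
have cfar : closed far.
  rewrite (_ : far = @normc R @^-1` [set x | r2 <= x]) //.
  by apply: closed_comp; [move=> z _; exact: continuous_normc|exact: closed_ge].
pose Y2 := (X `\` X') `|` far.
have cY2 : closed Y2 by exact: closedU.
have Y2r1 z : Y2 z -> r1 < normc z.
  move=> [[Xz nX'z]|/(lt_le_trans r12) //]; rewrite ltNge; apply/negP => h; apply: nX'z.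
  by apply: X'near => // ?; apply: Xz; [left|right].
(* Beyond radius [r1] the point [z] is farther from [w2] than [w1] is, so the quotient lies in the
   right half-plane. *)
have aY2 : has_angle Y2 (fun z => (z - w1) / (z - w2)).
  apply: has_angle_div; [exact: continuous_subC|exact: continuous_subC|].
  move=> z /Y2r1; rewrite /r1 => h.
  have -> : z - w1 - (z - w2) = w2 - w1 by ring.
  have h1 : normc (w2 - w1) <= normc w2 + normc w1.
    by apply: le_trans (ler_normcD _ _) _; rewrite normc_opp.
  have h2 := ler_normcB z w2.
  by apply: le_lt_trans h1 _; apply: lt_le_trans h2; lra.
have X'Y2 : X' `&` Y2 = set0.
  rewrite -subset0 => z [X'z [[]//|]]; rewrite /far /= leNgt => /negP; apply.
  exact: X'r2.
have [t [tc [M tM] tE]] := has_angle_setU cX' cY2 X'Y2 aX' aY2.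
set Y := X' `|` Y2 in tc tM tE.
have cY : closed Y by exact: closedU.
(* Tietze's theorem, with [Num.max 1 M] as a positive bound. *)
have [|||T [Tt Tc TM]] := continuous_bounded_extension (normal_spaceC (R := R)) cY (f := t) (M := Num.max 1 M).
- by rewrite lt_max ltr01.
- exact: tc.
- by move=> z /tM h; rewrite le_max h orbT.
have XY : X `<=` Y.
  by move=> z Xz; have [?|?] := pselect (X' z); [left|right; left].
pose u z : C := z / (normc z)%:C.
have uc z : z != 0 -> {for z, continuous u} by exact: continuous_normalize.
pose F z := expi (T z) * u (z - w2).
pose G z := u (z - w1).
have ucw w z : z != w -> {for z, continuous (fun z => u (z - w))}.
  move=> zw; have zw0 : z - w != 0 by rewrite subr_eq0.
  exact: (continuous_comp (@continuous_subC _ w z) (uc _ zw0)).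
have Fc z : z != w2 -> {for z, continuous F}.
  move=> zw; exact: (cvgM (continuous_cvg _ (@continuous_expi R _) (Tc z)) (ucw _ _ zw)).
have Gc z : z != w1 -> {for z, continuous G} by exact: ucw.
have FG z : Y z -> z != w1 -> z != w2 -> F z = G z.
  move=> Yz; rewrite -!(subr_eq0 z) /F /G /u -(Tt z) ?inE // => a0 b0.
  have := tE z Yz; rewrite normcM normcV rmorphM /= fmorphV /=.
  move: a0 b0; set a := z - w1; set b := z - w2; set e := expi _ => a0 b0 abE.
  have na0 : (normc a)%:C != 0 :> C by apply: contra a0 => /eqP/complexI/eqP; rewrite normc_eq0.
  have nb0 : (normc b)%:C != 0 :> C by apply: contra b0 => /eqP/complexI/eqP; rewrite normc_eq0.
  have aE : a = (normc a)%:C / (normc b)%:C * e * b by rewrite -abE divfK.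
  rewrite [X in _ = X / _]aE; move: na0 nb0.
  by move: (normc a)%:C (normc b)%:C => x y x0 y0; field; rewrite x0 y0.
(* The singularity [w2] of [F] lies outside [U1] and the singularity [w1] of [G] inside it; on [Y],
   away from these points, [F] and [G] agree. *)
pose k z := if z \in U1 then F z else G z.
have nU1w2 : ~ U1 w2 by move=> h; have : (U1 `&` U2) w2 by []; rewrite U12.
have nU2w1 : ~ U2 w1 by move=> h; have : (U1 `&` U2) w1 by []; rewrite U12.
have kc : continuous k.
  move=> z; have [U1z|nU1z] := pselect (U1 z).
    have zw2 : z != w2 by apply/eqP => h; rewrite h in U1z.
    have E : \forall w \near z, F w = k w.
      have : nbhs z U1 by exact: open_nbhs_nbhs.
      by apply: filterS => w U1w; rewrite /k mem_set.
    have kz : k z = F z by rewrite /k mem_set.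
    rewrite /continuous_at kz; exact: (cvg_trans (near_eq_cvg E) (Fc z zw2)).
  have [U2z|nU2z] := pselect (U2 z).
    have zw1 : z != w1 by apply/eqP => h; rewrite h in U2z.
    have E : \forall w \near z, G w = k w.
      have : nbhs z U2 by exact: open_nbhs_nbhs.
      apply: filterS => w U2w; rewrite /k memNset // => U1w.
      by have : (U1 `&` U2) w by []; rewrite U12.
    have kz : k z = G z by rewrite /k memNset.
    rewrite /continuous_at kz; exact: (cvg_trans (near_eq_cvg E) (Gc z zw1)).
  have zw1 : z != w1 by apply/eqP => h; rewrite h in nU1z.
  have zw2 : z != w2 by apply/eqP => h; rewrite h in nU2z.
  apply: continuous_if; [|exact: Fc|exact: Gc].
  by apply: FG => //; apply: XY => -[].
have u0 z : z != 0 -> u z != 0.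
  move=> z0; rewrite /u mulf_neq0 // invr_eq0.
  by rewrite -normc_eq0 in z0; apply: contra z0 => /eqP/complexI ->.
have e0 s : expi s != 0 :> C by rewrite -normc_gt0 normc_expi.
have k0 z : k z != 0.
  rewrite /k; case: ifPn => [/set_mem U1z|/negP nU1z].
    rewrite /F mulf_neq0 // u0 // subr_eq0; apply/eqP => h; by rewrite h in U1z.
  rewrite /G u0 // subr_eq0; apply/eqP => h; apply: nU1z; by rewrite inE h.
pose r3 := r2 + normc w2 + normc w1 + 1.
have r30 : 0 < r3 by rewrite /r3 ltr_wpDl ?ltr01 // !addr_ge0 ?normc_ge0 // ltW // (le_lt_trans r10).
apply: (@circle_no_angle R w2 r3 r30).
set S := [set z | _].
have SY z : S z -> [/\ Y z, z != w1 & z != w2].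
  rewrite /S /= => zr; have h : r2 + normc w1 + 1 <= normc z.
    have := ler_normcD z (- w2); rewrite normc_opp zr /r3.
    by rewrite addrAC -addrA addrAC addrA => ?; lra.
  split; first by right; right; rewrite /far /=; apply: le_trans h; rewrite -addrA lerDl addr_ge0 ?normc_ge0.
    apply/eqP => zw; move: h; rewrite zw; rewrite leNgt => /negP; apply.
    by rewrite addrAC ltrDr ltr_wpDl ?ltr01 // ltW // (le_lt_trans r10).
  by apply/eqP => zw; move: zr; rewrite zw subrr normc0 => h'; rewrite -h' ltxx in r30.
have ak : has_angle S k.
  apply: has_angle_sub (has_angle_disc w2 r3 kc k0) => z /= ->; exact: lexx.
have aT : has_angle S (fun z => expi (T z)).
  exists T; split; first exact: continuous_subspaceT.
    by exists (Num.max 1 M) => z _; exact: TM.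
  by move=> z _; rewrite normc_expi mul1r.
have ar : has_angle S (fun z => r3%:C).
  exact: has_angle_const.
(* On the circle [k] equals [F], so [z - w2] is the product of [r3], [k z] and the inverse of
   [expi (T z)]. *)
apply: has_angle_ext (has_angleM ar (has_angleM ak (has_angleV aT))) => z Sz.
have [Yz zw1 zw2] := SY _ Sz.
have -> : k z = F z by rewrite /k; case: ifP => // _; rewrite FG.
rewrite /F mulrAC divff // mul1r /u (_ : normc (z - w2) = r3) // mulrC divfK //.
by apply/eqP => /complexI r30'; rewrite r30' ltxx in r30.
Qed.

End separation.

(** * Derivatives and primitives *)

Section little_o.
Variable K : numFieldType.

Lemma derivable_little_o (f : K -> K) (z : K) : derivable f z 1 ->
  forall e, 0 < e -> exists2 r, 0 < r &
    forall h, `|h| < r -> `|f (z + h) - f z - 'D_1 f z * h| <= e * `|h|.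
Proof.
move=> fd e e0; pose d := 'D_1 f z.
have : \forall h \near 0^', `|d - h^-1 *: (f (h *: 1 + z) - f z)| < e.
  by move/cvgrPdist_lt : fd => /(_ _ e0).
move=> /nbhs_ballP[r /= r0 rP]; exists r => // h hr.
have [->|h0] := eqVneq h 0; first by rewrite addr0 subrr mulr0 subr0 normr0 mulr0.
have : ball (0 : K) r h by rewrite -ball_normE /= sub0r normrN.
move=> /rP/(_ h0)/ltW; rewrite scaler1 [h + z]addrC => hP.
rewrite -/d; have -> : f (z + h) - f z - d * h = - (d - h^-1 * (f (z + h) - f z)) * h by field.
by rewrite normrM normrN ler_wpM2r.
Qed.

Lemma little_o_is_derive (f : K -> K) (z d : K) :
  (forall e, 0 < e -> exists2 r, 0 < r &
    forall h, `|h| < r -> `|f (z + h) - f z - d * h| <= e * `|h|) ->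
  is_derive z 1 f d.
Proof.
move=> H.
have fd : h^-1 *: (f (h *: 1 + z) - f z) @[h --> 0^'] --> d.
  apply/cvgrPdist_le => e e0; have [r r0 rP] := H e e0.
  apply/nbhs_ballP; exists r => // h; rewrite -ball_normE /= sub0r normrN => /rP hP h0.
  rewrite -(ler_pM2r (_ : 0 < `|h|)) ?normr_gt0 //; apply: le_trans hP.
  rewrite -normrM -normrN scaler1 [h + z]addrC /GRing.scale /=.
  by rewrite (_ : - ((d - h^-1 * (f (z + h) - f z)) * h) = f (z + h) - f z - d * h) //; field.
split; first by apply/cvg_ex; exists d.
exact: (cvg_lim (@norm_hausdorff _ _) fd).
Qed.
End little_o.

Section real_primitive.
Variable R : realType.

(** The derivative as a first-order error estimate. [cderiv] and [rcderiv] have the same shape for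
    complex functions of a complex and of a real variable, so one kind of argument serves all
    three. *)
Definition rderiv (g : R -> R) (x d : R) := forall e, 0 < e -> exists2 r, 0 < r &
  forall h, `|h| < r -> `|g (x + h) - g x - d * h| <= e * `|h|.

Lemma rderiv_primitive_right (g : R -> R) (a : R) : continuous g ->
  exists G, forall x, a < x -> rderiv G x (g x).
Proof.
move=> gc; pose G (x : R) := (\int[lebesgue_measure]_(t in `[a, x]) g t)%R.
exists G => x ax.
have [||||Gd GE] := @continuous_FTC1 R g (BLeft a) x (x + 1).
- by rewrite ltrDl.
- apply: continuous_compact_integrable; first exact: segment_compact.
  exact: continuous_subspaceT.
- exact: ax.
- exact: gc.
by rewrite -GE derive1E; exact: (derivable_little_o Gd).
Qed.

Lemma rderiv_comp_opp (g : R -> R) (x d : R) : rderiv g (- x) d ->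
  rderiv (fun y => - g (- y)) x d.
Proof.
move=> H e e0; have [r r0 rP] := H e e0; exists r => // h hr.
have := rP (- h); rewrite normrN => /(_ hr).
have -> : - g (- (x + h)) - - g (- x) - d * h = - (g (- x - h) - g (- x) - d * - h).
  by rewrite (opprD x h); ring.
by rewrite normrN.
Qed.

Lemma rderiv_shift (g : R -> R) (x d c : R) : rderiv g x d -> rderiv (fun y => g y + c) x d.
Proof.
move=> H e e0; have [r r0 rP] := H e e0; exists r => // h /rP; congr (`|_| <= _); ring.
Qed.

Lemma rderiv_ext_near (g k : R -> R) (x d r : R) : 0 < r ->
  (forall y, `|y - x| < r -> g y = k y) -> rderiv g x d -> rderiv k x d.
Proof.
move=> r0 gk H e e0; have [r' r'0 rP] := H e e0; exists (Num.min r r').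
  by rewrite lt_min r0.
move=> h; rewrite lt_min => /andP[hr hr']; rewrite -!gk ?subrr ?normr0 //; first exact: rP.
by rewrite addrC addKr.
Qed.

(* The primitives on the half-lines to the right of [-1] and to the left of [1],
   both normalized to vanish at [0], are glued at [0]. *)
Lemma rderiv_primitive (g : R -> R) : continuous g ->
  exists G, forall x, rderiv G x (g x).
Proof.
move=> gc; have [P PP] := rderiv_primitive_right (-1) gc.
have gNc : continuous (fun x => g (- x)).
  move=> x; apply: continuous_comp; [exact: oppr_continuous|exact: gc].
have [N NP] := rderiv_primitive_right (-1) gNc.
pose P0 x := P x - P 0.
pose N0 x := - N (- x) + N 0.
have P0P x : -1 < x -> rderiv P0 x (g x) by move=> /PP; exact: rderiv_shift.
have N0P x : x < 1 -> rderiv N0 x (g x).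
  move=> x1; apply: rderiv_shift; apply: rderiv_comp_opp.
  by rewrite -{2}[x]opprK; apply: NP; rewrite ltrN2.
have P00 : P0 0 = 0 by rewrite /P0 subrr.
have N00 : N0 0 = 0 by rewrite /N0 oppr0 addNr.
exists (fun x => if 0 <= x then P0 x else N0 x) => x.
have [x0|x0|<-] := ltgtP 0 x.
- apply: (@rderiv_ext_near P0 _ _ _ x) => //; last by apply: P0P; apply: lt_trans x0; rewrite ltrN10.
  move=> y; rewrite ltr_norml => /andP[]; rewrite ltrBrDr addNr => /ltW ->//.
- apply: (@rderiv_ext_near N0 _ _ _ (- x)); rewrite ?oppr_gt0 //; last by apply: N0P; apply: lt_trans x0 _; rewrite ltr01.
  by move=> y; rewrite ltr_norml => /andP[_]; rewrite ltrBlDr addNr ltNge => /negbTE ->.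
- move=> e e0; have [r r0 rP] := P0P 0 (ltrN10 _) e e0.
  have [r' r'0 rP'] := N0P 0 ltr01 e e0.
  exists (Num.min r r'); first by rewrite lt_min r0.
  move=> h; rewrite lt_min => /andP[hr hr']; rewrite lexx /= P00.
  case: ifP => _; first by have := rP h hr; rewrite P00.
  by have := rP' h hr'; rewrite N00.
Qed.

(** The mean value theorem; bounding [g] on an interval centred at [a] avoids assuming an order
    between [a] and [b]. *)
Lemma rderiv_bound (G g : R -> R) (a b eta : R) : (forall x, rderiv G x (g x)) ->
  (forall x, `|x - a| <= `|b - a| -> `|g x| <= eta) ->
  `|G b - G a| <= eta * `|b - a|.
Proof.
move=> Gg geta.
have Gd (x : R) : is_derive x (1 : R) G (g x) by apply: little_o_is_derive; exact: Gg.
have Gc (x y : R) : {within `[x, y], continuous G}.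
  apply: continuous_subspaceT => z; apply: differentiable_continuous.
  by apply/derivable1_diffP; have [] := Gd z.
have [ab|ba] := leP a b.
  have [c] := MVT_segment ab (fun x _ => Gd x) (Gc _ _).
  rewrite in_itv /= => /andP[ac cb] ->; rewrite normrM ler_wpM2r //.
  apply: geta; rewrite !ger0_norm ?subr_ge0 //; exact: lerB.
have [c] := MVT_segment (ltW ba) (fun x _ => Gd x) (Gc _ _).
rewrite in_itv /= => /andP[bc ca] GE.
rewrite distrC GE normrM [X in _ <= _ * X]distrC ler_wpM2r //.
by apply: geta; rewrite distrC [leRHS]distrC !ger0_norm ?subr_ge0 ?(ltW ba) // lerB.
Qed.

End real_primitive.

Section complex_derivative.
Variable R : realType.
Local Notation C := R[i].
Local Notation Re := (@complex.Re R).
Local Notation Im := (@complex.Im R).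

Definition cderiv (f : C -> C) (z d : C) := forall e : R, 0 < e -> exists2 r : R, 0 < r &
  forall h, normc h < r -> normc (f (z + h) - f z - d * h) <= e * normc h.

Definition rcderiv (g : R -> C) (x : R) (d : C) := forall e : R, 0 < e -> exists2 r : R, 0 < r &
  forall h : R, `|h| < r -> normc (g (x + h) - g x - d * h%:C) <= e * `|h|.

Lemma derivable_cderiv (f : C -> C) z : derivable f z 1 -> exists d, cderiv f z d.
Proof.
move=> /derivable_little_o dP; exists ('D_1 f z) => e e0.
have e0' : 0 < e%:C by rewrite ltcR.
have [r r0 rP] := dP _ e0'.
move: r0; rewrite ltcE /= => /andP[/eqP ri r0]; exists (Re r) => // h hr.
rewrite -lecR rmorphM /= -!normrcE; apply: rP.
by rewrite normrcE ltcE /= ri eqxx.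
Qed.

Lemma rcderiv_Re g x d : rcderiv g x d -> rderiv (fun x => Re (g x)) x (Re d).
Proof.
move=> H e e0; have [r r0 rP] := H e e0; exists r => // h /rP; apply: le_trans.
apply: le_trans (ler_Re_normc _); rewrite le_eqVlt; apply/orP; left.
by case: (g (x + h)) => ? ?; case: (g x) => ? ?; case: d {H rP} => ? ? /=; rewrite mulr0 subr0.
Qed.

Lemma rcderiv_Im g x d : rcderiv g x d -> rderiv (fun x => Im (g x)) x (Im d).
Proof.
move=> H e e0; have [r r0 rP] := H e e0; exists r => // h /rP; apply: le_trans.
apply: le_trans (ler_Im_normc _); rewrite le_eqVlt; apply/orP; left.
by case: (g (x + h)) => ? ?; case: (g x) => ? ?; case: d {H rP} => ? ? /=; rewrite mulr0 add0r.
Qed.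

Lemma rderiv_complex (a b : R -> R) x (d d' : R) : rderiv a x d -> rderiv b x d' ->
  rcderiv (fun x => a x +i* b x) x (d +i* d').
Proof.
move=> H H' e e0; have e20 : 0 < e / 2 by rewrite divr_gt0.
have [r r0 rP] := H _ e20; have [r' r'0 rP'] := H' _ e20.
exists (Num.min r r'); first by rewrite lt_min r0.
move=> h; rewrite lt_min => /andP[/rP k /rP' k'].
apply: le_trans (ler_normc_ReIm _) _; rewrite /= !mulr0 subr0 add0r.
by rewrite (splitr e) mulrDl; exact: lerD.
Qed.

Lemma rcderiv_primitive (g : R -> C) : continuous g -> exists G, forall x, rcderiv G x (g x).
Proof.
move=> gc.
have [a aP] : exists a, forall x, rderiv a x (Re (g x)).
  apply: (@rderiv_primitive R (fun x => Re (g x))) => x.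
  exact: (continuous_cvg _ (@continuous_Re R _) (gc x)).
have [b bP] : exists b, forall x, rderiv b x (Im (g x)).
  apply: (@rderiv_primitive R (fun x => Im (g x))) => x.
  exact: (continuous_cvg _ (@continuous_Im R _) (gc x)).
exists (fun x => a x +i* b x) => x.
by have := rderiv_complex (aP x) (bP x); case: (g x).
Qed.

(** The factor 2 comes from treating real and imaginary parts separately. *)
Lemma rcderiv_bound (G g : R -> C) (a b eta : R) : (forall x, rcderiv G x (g x)) ->
  (forall x, `|x - a| <= `|b - a| -> normc (g x) <= eta) ->
  normc (G b - G a) <= 2 * eta * `|b - a|.
Proof.
move=> Gg geta.
have hR := @rderiv_bound R (fun x => Re (G x)) (fun x => Re (g x)) a b eta.
have hI := @rderiv_bound R (fun x => Im (G x)) (fun x => Im (g x)) a b eta.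
apply: le_trans (ler_normc_ReIm _) _.
rewrite -mulrA mulr_natl mulr2n; apply: lerD.
  rewrite (_ : Re _ = Re (G b) - Re (G a)); last by case: (G b); case: (G a).
  apply: hR => x; first exact: rcderiv_Re.
  by move=> /geta; apply: le_trans; exact: ler_Re_normc.
rewrite (_ : Im _ = Im (G b) - Im (G a)); last by case: (G b); case: (G a).
apply: hI => x; first exact: rcderiv_Im.
by move=> /geta; apply: le_trans; exact: ler_Im_normc.
Qed.

Lemma rcderivD (g k : R -> C) x d d' : rcderiv g x d -> rcderiv k x d' ->
  rcderiv (fun x => g x + k x) x (d + d').
Proof.
move=> H H' e e0; have e20 : 0 < e / 2 by rewrite divr_gt0.
have [r r0 rP] := H _ e20; have [r' r'0 rP'] := H' _ e20.
exists (Num.min r r'); first by rewrite lt_min r0.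
move=> h; rewrite lt_min => /andP[/rP q /rP' q'].
rewrite (_ : _ - _ = (g (x + h) - g x - d * h%:C) + (k (x + h) - k x - d' * h%:C)); last by ring.
apply: le_trans (ler_normcD _ _) _.
by rewrite (splitr e) mulrDl; exact: lerD.
Qed.

Lemma rcderivM c (g : R -> C) x d : rcderiv g x d -> rcderiv (fun x => c * g x) x (c * d).
Proof.
(* Adding 1 keeps the denominator positive when [c = 0]. *)
move=> H e e0; have c0 : 0 < normc c + 1 by rewrite ltr_wpDl ?normc_ge0.
have [r r0 rP] := H (e / (normc c + 1)) (divr_gt0 e0 c0).
exists r => // h /rP q.
rewrite (_ : _ - _ = c * (g (x + h) - g x - d * h%:C)); last by ring.
rewrite normcM; apply: le_trans (ler_wpM2l (normc_ge0 _) q) _.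
rewrite mulrA ler_wpM2r // mulrCA ler_piMr ?(ltW e0) // ler_pdivrMr // mul1r lerDl.
exact: ler01.
Qed.

Lemma rcderivB (g k : R -> C) x d d' : rcderiv g x d -> rcderiv k x d' ->
  rcderiv (fun x => g x - k x) x (d - d').
Proof.
move=> H H'; have := rcderivD H (rcderivM (-1) H'); rewrite mulN1r.
by rewrite (_ : (fun x => g x + -1 * k x) = (fun x => g x - k x)) //; apply/funext => y; rewrite mulN1r.
Qed.

Lemma cderiv_line f z th d (x : R) : cderiv f (z + x%:C * th) d ->
  rcderiv (fun s => f (z + s%:C * th)) x (th * d).
Proof.
move=> H e e0; have c0 : 0 < normc th + 1 by rewrite ltr_wpDl ?normc_ge0.
have [r r0 rP] := H (e / (normc th + 1)) (divr_gt0 e0 c0).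
exists (r / (normc th + 1)); first exact: divr_gt0.
move=> h; rewrite ltr_pdivlMr // => hr.
have nh : normc (h%:C * th) <= `|h| * (normc th + 1).
  by rewrite normcM normc_real ler_wpM2l // lerDl ler01.
have := rP (h%:C * th) (le_lt_trans nh hr).
rewrite (_ : z + (x + h)%:C * th = z + x%:C * th + h%:C * th); last by rewrite rmorphD /=; ring.
rewrite (_ : th * d * h%:C = d * (h%:C * th)); last by ring.
move=> q; apply: le_trans q _; apply: le_trans (ler_wpM2l (ltW (divr_gt0 e0 c0)) nh) _.
by rewrite mulrCA mulrC divfK // gt_eqF.
Qed.

Lemma cderiv_continuous f z d : cderiv f z d -> {for z, continuous f}.
Proof.
move=> H; apply/(@cvg_toCP _ _ (nbhs z)) => e e0; have [r r0 rP] := H 1 ltr01.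
have c0 : 0 < normc d + 1 by rewrite ltr_wpDl ?normc_ge0.
apply/nbhsCP; exists (Num.min r (e / (normc d + 1))); first by rewrite lt_min r0 divr_gt0.
move=> w; rewrite lt_min ltr_pdivlMr // => /andP[/rP q we].
move: q; rewrite [z + _]addrC subrK mul1r => q.
apply: le_lt_trans we.
have -> : normc (w - z) * (normc d + 1) = normc (w - z) + normc d * normc (w - z) by ring.
rewrite (_ : f w - f z = (f w - f z - d * (w - z)) + d * (w - z)); last by ring.
by apply: le_trans (ler_normcD _ _) _; rewrite normcM lerD2r.
Qed.

End complex_derivative.

(** * Goursat's lemma *)

Section goursat.
Variable R : realType.
Local Notation C := R[i].
Local Notation Re := (@complex.Re R).
Local Notation Im := (@complex.Im R).
Variables (f : C -> C) (f' : C -> C).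
Hypothesis ff' : forall z, cderiv f z (f' z).
Variables A B : R -> R -> C.
Hypothesis A_prim : forall x y, rcderiv (A y) x (f (x +i* y)).
Hypothesis B_prim : forall x y, rcderiv (B x) y (f (x +i* y)).

(* The integral of [f] along the boundary of the rectangle [[a, b] x [c, e]];
   [A y] and [B x] are primitives of [f] along horizontal and vertical lines. *)
Definition rect_int (a b c e : R) : C :=
  (A c b - A c a) - (A e b - A e a) + 'i * ((B b e - B b c) - (B a e - B a c)).

Lemma line_re (g : C -> C) d x y : cderiv g (x +i* y) d ->
  rcderiv (fun s => g (s +i* y)) x d.
Proof.
move=> H; have := @cderiv_line R g (0 +i* y) 1 d x.
rewrite (_ : (0 +i* y) + x%:C * 1 = x +i* y); last by apply/eqP; rewrite eq_complex /= !mulr1 !mul0r mulr0 subr0 !addr0 add0r !eqxx.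
move=> /(_ H); rewrite mul1r (_ : (fun s => _) = (fun s => g (s +i* y))) //; apply/funext => s.
by congr (g _); apply/eqP; rewrite eq_complex /= !mulr1 !mul0r mulr0 subr0 !addr0 add0r !eqxx.
Qed.

Lemma line_im (g : C -> C) d x y : cderiv g (x +i* y) d ->
  rcderiv (fun s => g (x +i* s)) y ('i * d).
Proof.
move=> H; have := @cderiv_line R g x%:C 'i d y.
rewrite (_ : x%:C + y%:C * 'i = x +i* y); last by apply/eqP; rewrite eq_complex /= !mulr1 !mul0r mulr0 subr0 !addr0 add0r !eqxx.
move=> /(_ H); rewrite (_ : (fun s => _) = (fun s => g (x +i* s))) //; apply/funext => s.
by congr (g _); apply/eqP; rewrite eq_complex /= !mulr1 !mul0r mulr0 subr0 !addr0 add0r !eqxx.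
Qed.

Lemma cderiv_quadratic (al be z : C) :
  cderiv (fun w => al * w + be * (w * w) / 2) z (al + be * z).
Proof.
move=> e e0; have c0 : 0 < normc be + 1 by rewrite ltr_wpDl ?normc_ge0.
exists (e / (normc be + 1)); first exact: divr_gt0.
move=> h; rewrite ltr_pdivlMr // => hr.
rewrite (_ : _ - _ = (be * h) / 2 * h); last by field.
rewrite normcM ler_wpM2r ?normc_ge0 // normcM normcV.
rewrite -[normc 2]/(normc (2%:R : C)) (_ : 2%:R = (2%:R : R)%:C); last by rewrite rmorph_nat.
rewrite normc_real ger0_norm // normcM; apply: (@le_trans _ _ (normc be * normc h)).
  by rewrite ler_piMr ?mulr_ge0 ?normc_ge0 // invf_le1 // ler1n.
by apply: ltW; apply: le_lt_trans hr; rewrite mulrC ler_wpM2l ?normc_ge0 // lerDl.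
Qed.

Lemma mul_imaginary : ('i * 'i : C) = -1.
Proof. by apply/eqP; rewrite eq_complex /= !mulr0 !mul0r mulr1 sub0r addr0 oppr0 !eqxx. Qed.

Lemma normc_imaginary : normc ('i : C) = 1.
Proof. by rewrite /= expr0n /= add0r expr1n sqrtr1. Qed.

(** The affine part has the primitive [P], so it contributes nothing around the rectangle; each side
    then contributes at most [2 * eta] times its length. *)
Lemma rect_int_small (al be : C) (a b c e eta : R) :
  (forall x y, `|x - a| <= `|b - a| -> `|y - c| <= `|e - c| ->
     normc (f (x +i* y) - (al + be * (x +i* y))) <= eta) ->
  normc (rect_int a b c e) <= 4 * eta * (`|b - a| + `|e - c|).
Proof.
move=> H; pose P w := al * w + be * (w * w) / 2.
have PP z : cderiv P z (al + be * z) by exact: cderiv_quadratic.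
pose A' y x := A y x - P (x +i* y).
(* Differentiating [P] vertically produces a factor ['i], which [- 'i] removes. *)
pose B' x y := B x y - (- 'i) * P (x +i* y).
have A'P y x : rcderiv (A' y) x (f (x +i* y) - (al + be * (x +i* y))).
  by apply: rcderivB; [exact: A_prim|exact: line_re].
have B'P x y : rcderiv (B' x) y (f (x +i* y) - (al + be * (x +i* y))).
  apply: rcderivB; first exact: B_prim.
  have := rcderivM (- 'i) (line_im (PP (x +i* y))).
  by rewrite mulrA mulNr mul_imaginary opprK mul1r.
have -> : rect_int a b c e = (A' c b - A' c a) - (A' e b - A' e a) +
    'i * ((B' b e - B' b c) - (B' a e - B' a c)).
  rewrite /rect_int /A' /B'.
  move: (P (b +i* c)) (P (a +i* c)) (P (b +i* e)) (P (a +i* e)) => p1 p2 p3 p4.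
  have : ('i : C) * 'i + 1 = 0 by rewrite mul_imaginary addNr.
  move: ('i : C) => i0 i1.
  apply/eqP; rewrite -subr_eq0; apply/eqP.
  transitivity ((i0 * i0 + 1) * (p1 - p2 - p3 + p4)); last by rewrite i1 mul0r.
  by ring.
have hA y : `|y - c| <= `|e - c| -> normc (A' y b - A' y a) <= 2 * eta * `|b - a|.
  by move=> yc; apply: (rcderiv_bound (A'P y)) => x xa; exact: H.
have hB x : `|x - a| <= `|b - a| -> normc (B' x e - B' x c) <= 2 * eta * `|e - c|.
  by move=> xa; apply: (rcderiv_bound (B'P x)) => y yc; exact: H.
apply: le_trans (ler_normcD _ _) _; rewrite normcM normc_imaginary mul1r.
have h1 := ler_normcD (A' c b - A' c a) (- (A' e b - A' e a)).
have h2 := ler_normcD (B' b e - B' b c) (- (B' a e - B' a c)).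
rewrite !normc_opp in h1 h2.
have := hA c; rewrite subrr normr0 normr_ge0 => /(_ isT) h3.
have := hA e; rewrite lexx => /(_ isT) h4.
have := hB a; rewrite subrr normr0 normr_ge0 => /(_ isT) h5.
have := hB b; rewrite lexx => /(_ isT) h6.
rewrite mulrDr; lra.
Qed.

Lemma rect_int_split a m b c n e : rect_int a b c e =
  rect_int a m c n + rect_int m b c n + (rect_int a m n e + rect_int m b n e).
Proof. by rewrite /rect_int; ring. Qed.

Lemma ReB (z w : C) : Re (z - w) = Re z - Re w.
Proof. by case: z; case: w. Qed.

Lemma ImB (z w : C) : Im (z - w) = Im z - Im w.
Proof. by case: z; case: w. Qed.

(** The four quarters add up to the whole integral, so one of them carries at least a quarter of it.
    Endpoints may come in either order, hence the absolute values. *)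
Lemma rect_int_quarter a b c e : exists r : (R * R) * (R * R),
  [/\ `|r.1.2 - r.1.1| = `|b - a| / 2, `|r.1.1 - a| <= `|b - a| / 2,
      `|r.2.2 - r.2.1| = `|e - c| / 2, `|r.2.1 - c| <= `|e - c| / 2 &
      normc (rect_int a b c e) <= 4 * normc (rect_int r.1.1 r.1.2 r.2.1 r.2.2)].
Proof.
have half (x y : R) : [/\ `|(x + y) / 2 - x| = `|y - x| / 2 & `|y - (x + y) / 2| = `|y - x| / 2].
  have -> : (x + y) / 2 - x = (y - x) / 2 by field.
  have -> : y - (x + y) / 2 = (y - x) / 2 by field.
  by rewrite normrM normfV (ger0_norm (ler0n _ 2)).
have [h1 h2] := half a b; have [h3 h4] := half c e.
set m := (a + b) / 2 in h1 h2; set n := (c + e) / 2 in h3 h4.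
apply: contrapT => H.
have key (r : (R * R) * (R * R)) : `|r.1.2 - r.1.1| = `|b - a| / 2 -> `|r.1.1 - a| <= `|b - a| / 2 ->
      `|r.2.2 - r.2.1| = `|e - c| / 2 -> `|r.2.1 - c| <= `|e - c| / 2 ->
      4 * normc (rect_int r.1.1 r.1.2 r.2.1 r.2.2) < normc (rect_int a b c e).
  by move=> *; rewrite ltNge; apply/negP => ?; apply: H; exists r; split.
have z1 : `|a - a| <= `|b - a| / 2 by rewrite subrr normr0 divr_ge0.
have z2 : `|c - c| <= `|e - c| / 2 by rewrite subrr normr0 divr_ge0.
have h1' : `|m - a| <= `|b - a| / 2 by rewrite h1.
have h3' : `|n - c| <= `|e - c| / 2 by rewrite h3.
have k1 := key ((a, m), (c, n)) h1 z1 h3 z2.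
have k2 := key ((m, b), (c, n)) h2 h1' h3 z2.
have k3 := key ((a, m), (n, e)) h1 z1 h4 h3'.
have k4 := key ((m, b), (n, e)) h2 h1' h4 h3'.
move: k1 k2 k3 k4 => /=; rewrite (rect_int_split a m b c n e).
move: (rect_int a m c n) (rect_int m b c n) (rect_int a m n e) (rect_int m b n e) => q1 q2 q3 q4.
have := ler_normcD (q1 + q2) (q3 + q4); have := ler_normcD q1 q2; have := ler_normcD q3 q4.
lra.
Qed.

(** Repeated quartering closes in on a point [z0]. Near [z0] the function is affine up to [ep] times
    the distance, so the integral over the [n]-th rectangle is at most a multiple of [ep / 4 ^ n],
    and the factor [4 ^+ n] lost by quartering is recovered. *)
Lemma goursat a b c e : rect_int a b c e = 0.
Proof.
pose next (r : (R * R) * (R * R)) := projT1 (cid (rect_int_quarter r.1.1 r.1.2 r.2.1 r.2.2)).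
have nextP r := projT2 (cid (rect_int_quarter r.1.1 r.1.2 r.2.1 r.2.2)).
pose rs n := iter n next ((a, b), (c, e)).
pose s := `|b - a|; pose t := `|e - c|.
have rsP n : [/\ `|(rs n).1.2 - (rs n).1.1| = s / 2 ^+ n, `|(rs n).2.2 - (rs n).2.1| = t / 2 ^+ n &
    normc (rect_int a b c e) <= 4 ^+ n * normc (rect_int (rs n).1.1 (rs n).1.2 (rs n).2.1 (rs n).2.2)].
  elim: n => [|n [IH1 IH2 IH3]]; first by rewrite /= !expr0 !divr1 mul1r.
  have [h1 _ h2 _ h3] := nextP (rs n).
  rewrite /rs iterS -/(rs n) /next !exprS !invfM; split.
  - by rewrite h1 IH1 [s / _ / _]mulrAC mulrA.
  - by rewrite h2 IH2 [t / _ / _]mulrAC mulrA.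
  - apply: le_trans IH3 _; rewrite [4 * _]mulrC -mulrA ler_wpM2l ?exprn_ge0 //.
(* These rectangles are centred at a corner of the [n]-th one with its sides as half-sides, so they
   are nested whatever the orientation. *)
pose K n := [set z : C | `|Re z - (rs n).1.1| <= s / 2 ^+ n /\ `|Im z - (rs n).2.1| <= t / 2 ^+ n].
have cK n : compact (K n).
  apply: compactC.
    exists ((s / 2 ^+ n + `|(rs n).1.1|) + (t / 2 ^+ n + `|(rs n).2.1|)) => z [zr zi].
    apply: le_trans (ler_normc_ReIm _) _; apply: lerD.
      by rewrite -lerBlDr; apply: le_trans zr; exact: lerB_dist.
    by rewrite -lerBlDr; apply: le_trans zi; exact: lerB_dist.
  rewrite (_ : K n = ((fun z => `|Re z - (rs n).1.1|) @^-1` [set x | x <= s / 2 ^+ n]) `&`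
                     ((fun z => `|Im z - (rs n).2.1|) @^-1` [set x | x <= t / 2 ^+ n])) //.
  have dist_cont (w : R) : continuous (fun x : R => `|x - w|).
    by move=> x; apply: cvg_norm; apply: cvgB; [exact: cvg_id|exact: cvg_cst].
  apply: closedI; (apply: closed_comp; last exact: closed_le) => z _.
    exact: (continuous_cvg _ (dist_cont _ _) (@continuous_Re R z)).
  exact: (continuous_cvg _ (dist_cont _ _) (@continuous_Im R z)).
have [z0 Kz0] : \bigcap_n K n !=set0.
  apply: (nested_compact_nonempty (hausdorffC R)) => // n.
    by exists ((rs n).1.1 +i* (rs n).2.1); split; rewrite /= subrr normr0 divr_ge0 ?exprn_ge0 ?normr_ge0.
  move=> z [zr zi]; have [_ h1 _ h2 _] := nextP (rs n).
  have [e1 e2 _] := rsP n.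
  have half (u : R) : u / 2 ^+ n = u / 2 ^+ n.+1 + u / 2 ^+ n / 2.
    by rewrite exprS invfM; field; rewrite expf_neq0.
  split.
    rewrite half; apply: le_trans (ler_distD ((rs n.+1).1.1) _ _) _; apply: lerD => //.
    by rewrite -e1.
  rewrite half; apply: le_trans (ler_distD ((rs n.+1).2.1) _ _) _; apply: lerD => //.
  by rewrite -e2.
apply/eqP; rewrite -normc_eq0 eq_le normc_ge0 andbT leNgt; apply/negP => q0.
set q := normc (rect_int a b c e) in q0 rsP.
pose L := s + t.
have L0 : 0 <= L by rewrite addr_ge0 ?normr_ge0.
have c0 : 0 < 16 * (L * L) + 1 by rewrite ltr_wpDl // mulr_ge0 // mulr_ge0.
(* The final bound is [8 * (L * L) * ep], which this choice makes smaller than [q]; the 1 covers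
   [L = 0]. *)
pose ep := q / (16 * (L * L) + 1).
have ep0 : 0 < ep by exact: divr_gt0.
have [r r0 rP] := ff' z0 ep0.
have [n nP] : exists n, 2 * L / 2 ^+ n < r.
  exists (Num.bound (2 * L / r)).
  rewrite ltr_pdivrMr ?exprn_gt0 // [r * _]mulrC -ltr_pdivrMr //.
  apply: lt_le_trans (archi_boundP _) _; first by rewrite divr_ge0 ?mulr_ge0 // ltW.
  by rewrite -natrX ler_nat ltnW // ltn_expl.
have [e1 e2 e3] := rsP n.
have [k1 k2] := Kz0 n I.
have pn0 : 0 < (2 : R) ^+ n by exact: exprn_gt0.
have small : normc (rect_int (rs n).1.1 (rs n).1.2 (rs n).2.1 (rs n).2.2) <=
    4 * (ep * (2 * L / 2 ^+ n)) * (s / 2 ^+ n + t / 2 ^+ n).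
  (* The comparison map is the affine approximation of [f] at [z0]. *)
  rewrite -e1 -e2; apply: (@rect_int_small (f z0 - f' z0 * z0) (f' z0)) => x y; rewrite e1 e2 => xa yc.
  have near : normc ((x +i* y) - z0) <= 2 * L / 2 ^+ n.
    apply: le_trans (ler_normc_ReIm _) _.
    have -> : 2 * L / 2 ^+ n = (s / 2 ^+ n + s / 2 ^+ n) + (t / 2 ^+ n + t / 2 ^+ n) by rewrite /L; ring.
    apply: lerD.
      rewrite ReB; apply: le_trans (ler_distD ((rs n).1.1) _ _) (lerD xa _).
      by rewrite distrC.
    rewrite ImB; apply: le_trans (ler_distD ((rs n).2.1) _ _) (lerD yc _).
    by rewrite distrC.
  have := rP ((x +i* y) - z0) (le_lt_trans near nP); rewrite [z0 + _]addrC subrK => h.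
  rewrite (_ : _ - _ = f (x +i* y) - f z0 - f' z0 * (x +i* y - z0)); last by ring.
  by apply: le_trans h _; rewrite ler_wpM2l // ltW.
have := le_trans e3 (ler_wpM2l (exprn_ge0 n (ler0n _ 4)) small).
have -> : 4 ^+ n * (4 * (ep * (2 * L / 2 ^+ n)) * (s / 2 ^+ n + t / 2 ^+ n)) = 8 * (L * L) * ep.
  rewrite (_ : (4 : R) ^+ n = 2 ^+ n * 2 ^+ n); last by rewrite -exprMn -natrM.
  by rewrite /L; field; rewrite gt_eqF.
have ql : 0 <= q * (L * L) by rewrite mulr_ge0 ?mulr_ge0 // ltW.
rewrite /ep (mulrA (8 * (L * L)) q) ler_pdivlMr // leNgt => /negP; apply.
rewrite [q * (_ + 1)]mulrDr mulr1 (_ : q * (16 * (L * L)) = 16 * (q * (L * L))); last by ring.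
rewrite (_ : 8 * (L * L) * q = 8 * (q * (L * L))); last by ring.
apply: (@le_lt_trans _ _ (16 * (q * (L * L)))); last by rewrite ltrDl.
by rewrite ler_wpM2r // ler_nat.
Qed.

End goursat.

(** * The maximum modulus principle *)

Section maximum_modulus.
Variable R : realType.
Local Notation C := R[i].
Local Notation Re := (@complex.Re R).
Local Notation Im := (@complex.Im R).

Lemma rcderiv_toC (x : R) : rcderiv (fun s : R => s%:C) x 1.
Proof.
move=> e e0; exists 1 => // h _.
have -> : (x + h)%:C - x%:C - 1 * h%:C = 0 :> C by rewrite rmorphD /=; ring.
by rewrite normc0 mulr_ge0 // ltW.
Qed.

Lemma cderiv_primitive (f f' : C -> C) : (forall z, cderiv f z (f' z)) ->
  exists F, forall z, cderiv F z (f z).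
Proof.
move=> ff'.
have fc : continuous f by move=> z; exact: cderiv_continuous (ff' z).
have [A AP] : exists A, forall y x, rcderiv (A y) x (f (x +i* y)).
  suff /choice[A AP] : forall y, exists G, forall x, rcderiv G x (f (x +i* y)) by exists A.
  move=> y; apply: (@rcderiv_primitive R (fun x => f (x +i* y))) => x.
  have h : ((t +i* y : C) @[t --> x]) --> (x +i* y : C).
    by apply: cvg_complex; [exact: cvg_id|exact: cvg_cst].
  exact: (continuous_cvg _ (fc _) h).
have [B BP] : exists B, forall x y, rcderiv (B x) y (f (x +i* y)).
  suff /choice[B BP] : forall x, exists G, forall y, rcderiv G y (f (x +i* y)) by exists B.
  move=> x; apply: (@rcderiv_primitive R (fun y => f (x +i* y))) => y.
  have h : ((x +i* t : C) @[t --> y]) --> (x +i* y : C).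
    by apply: cvg_complex; [exact: cvg_cst|exact: cvg_id].
  exact: (continuous_cvg _ (fc _) h).
(* Up to a constant, the integral of [f] from 0 along the real axis and then vertically to [z]. *)
exists (fun z => A 0 (Re z) + 'i * (B (Re z) (Im z) - B (Re z) 0)) => -[x y] e e0.
have e40 : 0 < e / 4 by rewrite divr_gt0.
have := fc (x +i* y) => /(@cvg_toCP _ _ (nbhs (x +i* y)))/(_ _ e40)/nbhsCP[d d0 dP].
exists (d / 2); first exact: divr_gt0.
move=> [k l].
have kh : `|k| <= normc (k +i* l) by exact: (ler_Re_normc (k +i* l)).
have lh : `|l| <= normc (k +i* l) by exact: (ler_Im_normc (k +i* l)).
move: kh lh; move: (normc (k +i* l)) => N kh lh hd; rewrite /= -/(x +i* y).
set fz := f (x +i* y) in dP *.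
have b1 : normc ((A y (x + k) - fz * (x + k)%:C) - (A y x - fz * x%:C)) <= 2 * (e / 4) * `|k|.
  have := @rcderiv_bound R (fun s => A y s - fz * s%:C) (fun s => f (s +i* y) - fz * 1) x (x + k) (e / 4).
  rewrite [x + k]addrC addrK; apply => s.
    apply: rcderivB; first exact: AP.
    apply: rcderivM; exact: rcderiv_toC.
  rewrite mulr1 => sx; apply: ltW; apply: dP.
  apply: le_lt_trans (ler_normc_ReIm _) _; rewrite /= subrr normr0 addr0.
  lra.
have b2 : normc ((B (x + k) (y + l) - fz * (y + l)%:C) - (B (x + k) y - fz * y%:C)) <= 2 * (e / 4) * `|l|.
  have := @rcderiv_bound R (fun s => B (x + k) s - fz * s%:C) (fun s => f ((x + k) +i* s) - fz * 1) y (y + l) (e / 4).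
  rewrite [y + l]addrC addrK; apply => s.
    apply: rcderivB; first exact: BP.
    apply: rcderivM; exact: rcderiv_toC.
  rewrite mulr1 => sx; apply: ltW; apply: dP.
  apply: le_lt_trans (ler_normc_ReIm _) _; rewrite /= addrAC subrr add0r.
  lra.
(* Goursat lifts the horizontal step from height 0 to height [y], so the increment becomes an
   integral over two short legs starting at [x +i* y]. *)
have := goursat ff' (fun x y => AP y x) BP x (x + k) 0 y; rewrite /rect_int => Q.
have -> : A 0 (x + k) + 'i * (B (x + k) (y + l) - B (x + k) 0) - (A 0 x + 'i * (B x y - B x 0)) -
    fz * (k +i* l) = ((A y (x + k) - fz * (x + k)%:C) - (A y x - fz * x%:C)) +
    'i * ((B (x + k) (y + l) - fz * (y + l)%:C) - (B (x + k) y - fz * y%:C)).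
  have -> : k +i* l = k%:C + 'i * l%:C.
    by apply/eqP; rewrite eq_complex /= !(mul0r, mul1r, mulr0, subr0, addr0, add0r, eqxx).
  rewrite !rmorphD /=; apply/eqP; rewrite -subr_eq0; apply/eqP; rewrite -[RHS]Q.
  by ring.
apply: le_trans (ler_normcD _ _) _; rewrite normcM normc_imaginary mul1r.
have ek : e * `|k| <= e * N by rewrite ler_pM2l.
have el : e * `|l| <= e * N by rewrite ler_pM2l.
lra.
Qed.

Lemma sqr_normc_ReIm (z : C) : normc z ^+ 2 = Re z ^+ 2 + Im z ^+ 2.
Proof. by case: z => a b /=; rewrite sqr_sqrtr // addr_ge0 ?sqr_ge0. Qed.

Lemma ler_Re_mul (c z : C) : Re (c * z) <= normc c * normc z.
Proof. by rewrite -normcM; apply: le_trans (ler_Re_normc _); exact: ler_norm. Qed.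

(* At an interior maximum of [Re (c U) + ep |z - w|^2], the mean over the four points
   [z + s th], with [th] in [1, -1, i, -i], would exceed the value at [z]: the sums of
   [th] and of [th^2] vanish, so the mean of [U] differs from [U z] by [o(s^2)]. *)
Lemma maximum_principle_C2 (U V W : C -> C) (G : set C) (m : R) : 0 <= m ->
  (forall z, cderiv U z (V z)) -> (forall z, cderiv V z (W z)) ->
  open G -> (exists r : R, forall z, G z -> normc z <= r) ->
  (forall z, closure G z -> ~ G z -> normc (U z) <= m) ->
  forall z, G z -> normc (U z) <= m.
Proof.
move=> m0 UV VW oG [r Gr] bd w Gw; rewrite leNgt; apply/negP => mU.
set n0 := normc (U w) in mU.
have n00 : 0 < n0 by exact: le_lt_trans mU.
(* With the conjugate of [U w] as factor, [Re (c * U z)] equals [n0 ^+ 2] at [w] and is at most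
   [n0 * m] on the frontier; [ep] below keeps the quadratic term under this gap [kap]. *)
pose c : C := (Re (U w)) -i* (Im (U w)).
have nc : normc c = n0 by rewrite /n0 /c; case: (U w) => a b /=; rewrite sqrrN.
have cU : Re (c * U w) = n0 ^+ 2.
  by rewrite sqr_normc_ReIm /c; case: (U w) => a b /=; rewrite mulNr opprK !expr2.
have clr z : closure G z -> normc z <= r.
  move=> clz; suff : closure [set z : C | normc z <= r] z.
    rewrite -(closure_id _).1 //.
    rewrite (_ : [set z | _] = @normc R @^-1` [set x | x <= r]) //.
    by apply: closed_comp; [move=> ? _; exact: continuous_normc|exact: closed_le].
  exact: closureS clz.
have cptG : compact (closure G) by apply: compactC; [exists r|exact: closed_closure].
pose kap := n0 ^+ 2 - n0 * m.
have kap0 : 0 < kap by rewrite /kap subr_gt0 expr2 ltr_pM2l.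
pose rho := r + r.
have rho_ub z : closure G z -> normc (z - w) <= rho.
  move=> /clr zr; apply: le_trans (ler_normcD _ _) _; rewrite normc_opp /rho.
  by apply: lerD => //; exact: Gr.
have d0 : 0 < rho ^+ 2 + 1 by rewrite ltr_wpDl ?sqr_ge0.
pose ep := kap / (rho ^+ 2 + 1).
have ep0 : 0 < ep by exact: divr_gt0.
have ep1 : ep * rho ^+ 2 < kap.
  have : ep * (rho ^+ 2 + 1) = kap by rewrite /ep divfK // gt_eqF.
  by rewrite mulrDr mulr1 => <-; rewrite ltrDl.
pose v z := Re (c * U z) + ep * normc (z - w) ^+ 2.
have vc : continuous v.
  move=> z.
  have Uc : {for z, continuous U} by exact: cderiv_continuous (UV z).
  have c1 : Re (c * U y) @[y --> z] --> Re (c * U z).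
    exact: (continuous_cvg _ (@continuous_Re R _) (cvgM (cvg_cst c) Uc)).
  have c2 : normc (y - w) @[y --> z] --> normc (z - w).
    exact: (continuous_cvg _ (@continuous_normc R _) (@continuous_subC R w z)).
  exact: (cvgD c1 (cvgM (cvg_cst ep) (cvgM c2 c2))).
have clw : closure G w by exact: subset_closure.
have [|z1 /set_mem clz1 z1max] := compact_EVT_max (ex_intro _ w clw) cptG (f := v).
  exact: continuous_subspaceT.
have {}z1max z : closure G z -> v z <= v z1 by move=> cz; apply: z1max; rewrite inE.
have vw : v w = n0 ^+ 2 by rewrite /v subrr normc0 expr0n /= mulr0 addr0.
have Gz1 : G z1.
  apply: contrapT => nG; have := z1max _ clw; rewrite vw leNgt => /negP; apply.
  have h1 := ler_Re_mul c (U z1); rewrite nc in h1.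
  have h2 : n0 * normc (U z1) <= n0 * m by rewrite ler_pM2l // bd.
  have h3 : ep * normc (z1 - w) ^+ 2 <= ep * rho ^+ 2.
    rewrite ler_pM2l // ler_pXn2r ?nnegrE ?normc_ge0 //; first exact: rho_ub.
    exact: le_trans (normc_ge0 _) (rho_ub _ clw).
  move: ep1 h1 h2 h3; rewrite /v /kap; lra.
have /nbhsCP[dl dl0 dlP] : nbhs z1 G by exact: open_nbhs_nbhs.
(* The four-point sum of [Re (c * U)] then drops by at most [2 * (ep * (s * s))], while the
   quadratic term gains [4 * (ep * (s * s))]. *)
pose eta := ep / (4 * n0).
have eta0 : 0 < eta by rewrite divr_gt0 // mulr_gt0.
have etaE : n0 * eta = ep / 4 by rewrite /eta; field; rewrite gt_eqF.
have [r1 r10 r1P] := VW z1 _ eta0.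
pose s := Num.min dl r1 / 2.
have mr : 0 < Num.min dl r1 by rewrite lt_min dl0.
have s0 : 0 < s by exact: divr_gt0.
have sm : s < Num.min dl r1 by rewrite /s ltr_pdivrMr // ltr_pMr // ltr1n.
have [sdl sr1] : s < dl /\ s < r1 by move: sm; rewrite lt_min => /andP[].
pose u th (x : R) := U (z1 + x%:C * th).
have uP th x : rcderiv (u th) x (th * V (z1 + x%:C * th)) by exact: cderiv_line.
pose Y x := u 1 x + u (-1) x + (u 'i x + u (- 'i) x).
pose Y' x := 1 * V (z1 + x%:C * 1) + -1 * V (z1 + x%:C * -1) +
  ('i * V (z1 + x%:C * 'i) + (- 'i) * V (z1 + x%:C * - 'i)).
have YP x : rcderiv Y x (Y' x).
  by apply: rcderivD; apply: rcderivD; exact: uP.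
have unit_th (x : R) th : normc th = 1 -> normc (x%:C * th) = `|x|.
  by move=> th1; rewrite normcM normc_real th1 mulr1.
have n1 : normc (1 : C) = 1 by exact: normc1.
have nN1 : normc (-1 : C) = 1 by rewrite normc_opp.
have ni : normc ('i : C) = 1 by exact: normc_imaginary.
have nNi : normc (- 'i : C) = 1 by rewrite normc_opp.
have Y'b x : `|x - 0| <= `|s - 0| -> normc (Y' x) <= 4 * (eta * s).
  rewrite !subr0 (gtr0_norm s0) => xs.
  pose q th := V (z1 + x%:C * th) - V z1 - W z1 * (x%:C * th).
  have qb th : normc th = 1 -> normc (th * q th) <= eta * s.
    move=> th1; rewrite normcM th1 mul1r.
    have := r1P (x%:C * th); rewrite unit_th // => /(_ (le_lt_trans xs sr1)) h.
    by apply: le_trans h _; rewrite ler_pM2l.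
  (* The terms in [V z1] and [W z1] cancel, since the directions and their squares sum to zero. *)
  have -> : Y' x = (1 * q 1 + -1 * q (-1)) + ('i * q 'i + (- 'i) * q (- 'i)).
    rewrite /Y' /q; have : ('i : C) * 'i + 1 = 0 by rewrite mul_imaginary addNr.
    move: (V (z1 + x%:C * 1)) (V (z1 + x%:C * -1)) (V (z1 + x%:C * 'i)) (V (z1 + x%:C * - 'i)).
    move: ('i : C) => i0 a b c' d i1; apply/eqP; rewrite -subr_eq0; apply/eqP.
    transitivity ((i0 * i0 + 1) * (2 * W z1 * x%:C)); last by rewrite i1 mul0r.
    by ring.
  apply: le_trans (ler_normcD _ _) _.
  have := ler_normcD (1 * q 1) (-1 * q (-1)).
  have := ler_normcD ('i * q 'i) (- 'i * q (- 'i)).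
  have := qb _ n1; have := qb _ nN1; have := qb _ ni; have := qb _ nNi.
  lra.
have := rcderiv_bound YP Y'b; rewrite subr0 (gtr0_norm s0) => YB.
have Y0 : Y 0 = 4 * U z1 by rewrite /Y /u !mul0r !addr0; ring.
have vth th : normc th = 1 -> v (z1 + s%:C * th) <= v z1.
  move=> th1; apply: z1max; apply: subset_closure; apply: dlP.
  by rewrite addrC addKr unit_th // gtr0_norm.
have := vth _ n1; have := vth _ nN1; have := vth _ ni; have := vth _ nNi.
have sq : normc (z1 + s%:C * 1 - w) ^+ 2 + normc (z1 + s%:C * -1 - w) ^+ 2 +
   (normc (z1 + s%:C * 'i - w) ^+ 2 + normc (z1 + s%:C * - 'i - w) ^+ 2) =
   4 * normc (z1 - w) ^+ 2 + 4 * (s * s).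
  rewrite !sqr_normc_ReIm; case: (z1) => a b; case: (w) => a' b' /=; ring.
have Rs : Re (c * (Y s - Y 0)) = Re (c * u 1 s) + Re (c * u (-1) s) +
   (Re (c * u 'i s) + Re (c * u (- 'i) s)) - 4 * Re (c * U z1).
  rewrite Y0 /Y; case: (c) => ? ?; case: (u 1 s) => ? ?; case: (u (-1) s) => ? ?.
  case: (u 'i s) => ? ?; case: (u (- 'i) s) => ? ?; case: (U z1) => ? ? /=; ring.
have h1 := ler_Re_mul (- c) (Y s - Y 0); rewrite normc_opp nc mulNr in h1.
have h2 : n0 * normc (Y s - Y 0) <= n0 * (2 * (4 * (eta * s)) * s) by rewrite ler_pM2l.
have h3 : n0 * (2 * (4 * (eta * s)) * s) = 2 * (ep * (s * s)).
  rewrite (_ : n0 * _ = n0 * eta * (8 * (s * s))); last by ring.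
  by rewrite etaE; field.
have h4 : Re (- (c * (Y s - Y 0))) = - Re (c * (Y s - Y 0)) by case: (c * _).
have h5 : 0 < ep * (s * s) by exact: mulr_gt0 ep0 (mulr_gt0 s0 s0).
have sq' := congr1 (fun t => ep * t) sq.
rewrite /v; rewrite /u in Rs; move: sq' Rs h1 h2 h3 h4 h5 YB; lra.
Qed.

Lemma cderiv_diff_quotient (F : C -> C) (z h k d d' : C) : cderiv F z d -> cderiv F (z + h) d' ->
  cderiv (fun w => k * (F (w + h) - F w)) z (k * (d' - d)).
Proof.
move=> H H' e e0; have c0 : 0 < 2 * (normc k + 1) by rewrite mulr_gt0 // ltr_wpDl ?normc_ge0.
have e'0 : 0 < e / (2 * (normc k + 1)) by exact: divr_gt0.
have [r r0 rP] := H _ e'0; have [r' r'0 rP'] := H' _ e'0.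
exists (Num.min r r'); first by rewrite lt_min r0.
move=> t; rewrite lt_min => /andP[/rP q /rP' q'].
rewrite (_ : _ - _ = k * ((F (z + h + t) - F (z + h) - d' * t) - (F (z + t) - F z - d * t))); last first.
  by rewrite (addrAC z t h); ring.
rewrite normcM.
have q2 := ler_normcD (F (z + h + t) - F (z + h) - d' * t) (- (F (z + t) - F z - d * t)).
rewrite normc_opp in q2; have := ler_wpM2l (normc_ge0 k) (le_trans q2 (lerD q' q)).
move=> /le_trans; apply.
have c1 : 0 < normc k + 1 by rewrite ltr_wpDl ?normc_ge0.
rewrite (_ : normc k * _ = (normc k / (normc k + 1)) * (e * normc t)); last by field; rewrite gt_eqF.
rewrite ler_piMl ?mulr_ge0 ?normc_ge0 ?(ltW e0) // ler_pdivrMr // mul1r lerDl.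
exact: ler01.
Qed.

Lemma uniform_shift (f : C -> C) (K : set C) (eta : R) : continuous f -> compact K -> 0 < eta ->
  \forall s \near (0 : R), forall z, K z -> normc (f (z + s%:C) - f z) < eta.
Proof.
move=> fc /compact_near_coveringP cvK eta0.
apply: (cvK _ (nbhs (0 : R)) (fun s z => normc (f (z + s%:C) - f z) < eta)) => z Kz.
pose k (p : C * R) := normc (f (p.1 + p.2%:C) - f p.1).
have kc : continuous k.
  move=> p.
  have c1 : (q.2%:C : C) @[q --> p] --> (p.2%:C : C).
    exact: (continuous_cvg _ (@continuous_toC R _) cvg_snd).
  have c0 : q.1 @[q --> p] --> p.1 by exact: cvg_fst.
  have c2 : f (q.1 + q.2%:C) @[q --> p] --> f (p.1 + p.2%:C).
    exact: (continuous_cvg _ (fc _) (cvgD c0 c1)).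
  have c3 : f q.1 @[q --> p] --> f p.1 by exact: (continuous_cvg _ (fc _) c0).
  exact: (continuous_cvg _ (@continuous_normc R _) (cvgB c2 c3)).
have k0 : k (z, 0) < eta by rewrite /k /= addr0 subrr normc0.
have : \forall p \near (z, (0 : R)), k p < eta.
  exact: (kc (z, 0) _ (open_nbhs_nbhs (conj (@open_lt R eta) k0))).
exact: filterS.
Qed.

(** The difference quotients [U] of a primitive have difference quotients of [f] and [f'] as
    successive derivatives, so the twice differentiable case applies to them. *)
Lemma maximum_modulus (f f' : C -> C) (G : set C) (m : R) : 0 <= m ->
  (forall z, cderiv f z (f' z)) -> open G ->
  (exists r : R, forall z, G z -> normc z <= r) ->
  (forall z, closure G z -> ~ G z -> normc (f z) <= m) ->
  forall z, G z -> normc (f z) <= m.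
Proof.
move=> m0 ff' oG [r Gr] bd w Gw; rewrite leNgt; apply/negP => mf.
have [F FP] := cderiv_primitive ff'.
have fc : continuous f by move=> z; exact: cderiv_continuous (ff' z).
have cptG : compact (closure G).
  apply: compactC; last exact: closed_closure.
  exists r => z clz; suff : closure [set z : C | normc z <= r] z.
    rewrite -(closure_id _).1 //.
    rewrite (_ : [set z | _] = @normc R @^-1` [set x | x <= r]) //.
    by apply: closed_comp; [move=> ? _; exact: continuous_normc|exact: closed_le].
  exact: closureS clz.
(* Replacing [f] by [U] costs [2 * eta] on the frontier and again at [w], less than the excess
   [8 * eta]. *)
pose eta := (normc (f w) - m) / 8.
have eta0 : 0 < eta by rewrite divr_gt0 // subr_gt0.
have [d /= d0 dP] := (nbhs_ballP _ _).1 (uniform_shift fc cptG eta0).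
pose h := d / 2.
have h0 : 0 < h by exact: divr_gt0.
have hd : h < d by rewrite /h ltr_pdivrMr // ltr_pMr // ltr1n.
have hC0 : (h%:C : C) != 0 by apply/eqP => /complexI h00; rewrite h00 ltxx in h0.
pose U z := (h%:C)^-1 * (F (z + h%:C) - F z).
have Uf z : closure G z -> normc (U z - f z) <= 2 * eta.
  move=> clz.
  have := @rcderiv_bound R (fun s => F (z + s%:C * 1) - f z * s%:C) (fun s => 1 * f (z + s%:C * 1) - f z * 1) 0 h eta.
  rewrite !subr0 (gtr0_norm h0) => H.
  have {}H : normc (F (z + h%:C * 1) - f z * h%:C - (F (z + 0%:C * 1) - f z * 0%:C)) <= 2 * eta * h.
    apply: H => s.
      apply: rcderivB; first by apply: cderiv_line; exact: FP.
      by apply: rcderivM; exact: rcderiv_toC.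
    rewrite subr0 mul1r !mulr1 => sh; apply: ltW; apply: (dP s) => //.
    by rewrite -ball_normE /= sub0r normrN; exact: le_lt_trans hd.
  rewrite mulr1 !mul0r addr0 mulr0 subr0 in H.
  rewrite (_ : U z - f z = (F (z + h%:C) - f z * h%:C - F z) * (h%:C)^-1); last by rewrite /U; field.
  by rewrite normcM normcV normc_real gtr0_norm // ler_pdivrMr.
have le_fU z : closure G z -> normc (U z) <= normc (f z) + 2 * eta.
  move=> clz; rewrite -(subrK (f z) (U z)) addrC; apply: le_trans (ler_normcD _ _) _.
  by rewrite lerD2l; exact: Uf.
have clw : closure G w by exact: subset_closure.
have : normc (U w) <= m + 2 * eta.
  apply: (maximum_principle_C2 (U := U) (V := fun z => (h%:C)^-1 * (f (z + h%:C) - f z))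
    (W := fun z => (h%:C)^-1 * (f' (z + h%:C) - f' z)) (G := G)) => //.
  - by rewrite addr_ge0 // mulr_ge0 // ltW.
  - by move=> z; apply: cderiv_diff_quotient; exact: FP.
  - by move=> z; apply: cderiv_diff_quotient; exact: ff'.
  - by exists r.
  - move=> z clz nGz; apply: le_trans (le_fU _ clz) _; rewrite lerD2r; exact: bd.
have h1 := Uf w clw; rewrite normc_distC in h1.
have h2 := ler_normcB (f w) (U w).
have h3 : normc (f w) - m = 8 * eta by rewrite /eta; field.
move: h1 h2 h3 eta0; lra.
Qed.

End maximum_modulus.

(** * Separation by continua of bounded orbits *)

Section assembly.
Variable R : realType.
Local Notation C := R[i].

Lemma cderiv_comp (f g : C -> C) (z d d' : C) : cderiv g z d -> cderiv f (g z) d' ->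
  cderiv (f \o g) z (d' * d).
Proof.
move=> H H' e e0.
have c0 : 0 < normc d + 1 by rewrite ltr_wpDl ?normc_ge0.
have c0' : 0 < normc d' + 1 by rewrite ltr_wpDl ?normc_ge0.
have e2 : 0 < e / 2 by rewrite divr_gt0.
have [r r0 rP] := H _ ltr01.
have [r1 r10 r1P] := H _ (divr_gt0 e2 c0').
have [r2 r20 r2P] := H' _ (divr_gt0 e2 c0).
exists (Num.min r (Num.min r1 (r2 / (normc d + 1)))).
  by rewrite !lt_min r0 r10 divr_gt0.
move=> h; rewrite !lt_min => /and3P[/rP q /r1P q1]; rewrite ltr_pdivlMr // => hr2.
set k := g (z + h) - g z in q q1.
have kb : normc k <= normc h * (normc d + 1).
  rewrite -[k](subrK (d * h)); apply: le_trans (ler_normcD _ _) _.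
  by rewrite mul1r in q; rewrite normcM mulrDr mulr1 addrC [normc d * _]mulrC lerD2l.
have gzk : g (z + h) = g z + k by rewrite /k [g z + _]addrC subrK.
have := r2P k (le_lt_trans kb hr2); rewrite -gzk => q2.
rewrite /= (_ : _ - _ = (f (g (z + h)) - f (g z) - d' * k) + d' * (k - d * h)); last by ring.
apply: le_trans (ler_normcD _ _) _; rewrite normcM.
rewrite [e in leRHS](splitr e) mulrDl; apply: lerD.
  apply: le_trans q2 _; apply: le_trans (ler_wpM2l _ kb) _; first by rewrite ltW // divr_gt0.
  by rewrite mulrCA mulrC divfK // gt_eqF.
apply: le_trans (ler_wpM2l (normc_ge0 _) q1) _.
rewrite mulrA ler_wpM2r ?normc_ge0 // mulrCA ler_piMr ?(ltW e2) //.
by rewrite ler_pdivrMr // mul1r lerDl.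
Qed.

Lemma cderiv_iter (f f' : C -> C) n : (forall z, cderiv f z (f' z)) ->
  exists g, forall z, cderiv (iter n f) z (g z).
Proof.
move=> ff'; elim: n => [|n [g gP]].
  exists (fun=> 1) => z e e0; exists 1 => // h _.
  rewrite /= (_ : z + h - z - 1 * h = 0); last by ring.
  by rewrite normc0 mulr_ge0 ?normc_ge0 // ltW.
exists (fun z => f' (iter n f z) * g z) => z.
exact: (cderiv_comp (gP z) (ff' _)).
Qed.

(** Each point of one set gets a disc of half the radius of a disc missing the other. If two such
    discs met, the larger doubled disc would contain the centre of the smaller one. *)
Lemma separated_open (A B : set C) : separated A B ->
  exists U V, [/\ open U, open V, A `<=` U, B `<=` V & U `&` V = set0].
Proof.
move=> [AB BA].
pose N (A B : set C) := [set x : C | exists2 z, A z & exists2 r : R,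
  normc (x - z) < r & forall y, normc (y - z) < r + r -> ~ B y].
have oN A' B' : open (N A' B').
  rewrite openE => x [z Az [r xr rB]]; apply/nbhsCP.
  exists (r - normc (x - z)); first by rewrite subr_gt0.
  move=> y; rewrite ltrBrDr => yx; exists z => //; exists r => //.
  by apply: le_lt_trans yx; exact: normc_triangle.
have AN A' B' : A' `&` closure B' = set0 -> A' `<=` N A' B'.
  move=> AB0 z Az; have nclz : ~ closure B' z.
    by move=> clz; have : (A' `&` closure B') z by []; rewrite AB0.
  have /nbhsCP[r r0 rP] : nbhs z (~` closure B').
    by apply: open_nbhs_nbhs; split => //; exact/closed_openC/closed_closure.
  exists z => //; exists (r / 2); first by rewrite subrr normc0 divr_gt0.
  by move=> y; rewrite -splitr => /rP h By; apply: h; exact: subset_closure.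
exists (N A B), (N B A); split => //; [exact: AN|by apply: AN; rewrite setIC|].
rewrite -subset0 => x [[z Az [r xr rB]] [z' Bz' [r' xr' rA]]].
have zz' : normc (z' - z) < r + r'.
  apply: le_lt_trans (normc_triangle z' x z) _.
  by rewrite normc_distC addrC; exact: ltrD.
have [rr'|/ltW r'r] := leP r r'.
  by apply: (rA z) => //; rewrite normc_distC; apply: lt_le_trans zz' _; rewrite lerD2r.
by apply: (rB z') => //; apply: lt_le_trans zz' _; rewrite lerD2l.
Qed.

End assembly.

Theorem theorem3p1 (R : realType) (f : R[i] -> R[i]) (D : nat -> set R[i])
  (f_transcendental : transcendental_entire f)
  (D_bounded : forall n, bounded_set (D n))
  (D_simply_connected : forall n, simply_connected (D n))
  (D_domain : forall n, domain (D n))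
  (f_surrounds : forall n, surrounds (f @` frontier (D n)) (D n.+1))
  (D_exhausts : forall r : R, 0 < r ->
    \forall n \near \oo, ball (0 : R[i]) r%:C `<=` D n) :
  connected (unbounded_orbit_set f).
Proof.
have [f' ff'] : exists f', forall z, cderiv f z (f' z).
  have [fe _] := f_transcendental.
  have /choice[g gP] : forall z, exists d, cderiv f z d by move=> z; exact: derivable_cderiv.
  by exists g.
have fc : continuous f by move=> z; exact: cderiv_continuous (ff' z).
have oD n : open (D n) by case: (D_domain n).
have bD n : exists r : R, forall z, D n z -> normc z <= r by exact/bounded_setCP.
have stepD n z : closure (D n) z -> ~ D n z -> ~ D n.+1 (f z).
  move=> clz nDz; have [x [_ _ sub]] := f_surrounds n => /sub/connected_component_sub; apply.
  by exists z => //; split => // /interior_subset.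
have exD (r : R) : exists N, forall n, (N <= n)%N -> [set z | normc z <= r] `<=` D n.
  have r0 : 0 < `|r| + 1 by rewrite ltr_wpDl.
  have [N _ NP] := D_exhausts _ r0; exists N => n /NP h z zr; apply: h.
  by rewrite ball0CE; apply: le_lt_trans zr _; apply: le_lt_trans (ler_norm r) _; rewrite ltrDl.
set E := unbounded_orbit_set f.
have notE z : ~ E z -> exists m, orbit_le f m z.
  move=> /contrapT/bounded_setCP[r rP]; exists (Num.max (normc z) r) => -[|n] /=.
    by rewrite le_max lexx.
  by rewrite le_max; apply/orP; right; apply: rP; exists n.+1.
have Eorbit z : E z -> forall m, ~ orbit_le f m z.
  move=> Ez m zm; apply: Ez; apply/bounded_setCP; exists m => _ [n _ <-]; exact: zm.
have orbK := orbit_le_connected fc oD bD stepD exD.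
have orbC := continuum_orbit_bounded fc oD bD stepD exD.
apply: contrapT => /connectedPn[F [F0 EF /separated_open[U0 [U1 [oU0 oU1 FU0 FU1 U01]]]]].
have [w0 F0w0] := F0 false; have [w1 F1w1] := F0 true.
have Ew0 : E w0 by rewrite EF; left.
have Ew1 : E w1 by rewrite EF; right.
pose X := ~` (U0 `|` U1).
have cX : closed X by apply: open_closedC; exact: openU.
have XE x : X x -> ~ E x.
  by move=> Xx; rewrite EF => -[/FU0|/FU1] h; apply: Xx; [left|right].
pose h z := (z - w0) / (z - w1).
(* Bounded relatively clopen parts of [X] on which [h] has an angle; they are stable under unions
   and, as shown below, cover [X]. *)
pose nice A := [/\ closed A, closed (X `\` A), A `<=` X,
  exists r : R, forall z, A z -> normc z < r & has_angle A h].
have nice0 : nice set0.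
  split => //; first exact: closed0.
  - by rewrite setD0.
  - by exists 0.
  - exists (fun=> 0); split => //; last by exists 0.
    by apply: continuous_subspaceT; exact: cst_continuous.
have niceU A B : nice A -> nice B -> nice (A `|` B).
  move=> [cA cXA AX [r Ar] aA] [cB cXB BX [r' Br'] aB]; split.
  - exact: closedU.
  - by rewrite setDUr; exact: closedI.
  - by move=> z [/AX|/BX].
  - exists (Num.max r r') => z [/Ar|/Br'] zr; rewrite lt_max zr ?orbT //.
  (* The union is made disjoint, with both pieces still closed, so that the angles can be glued. *)
  - have -> : A `|` B = A `|` (B `&` (X `\` A)).
      apply/seteqP; split => z [Az|Bz]; [by left| |by left|by right; case: Bz].
      by have [Az|nAz] := pselect (A z); [left|right; split => //; split => //; exact: BX].
    apply: has_angle_setU => //; first exact: closedI.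
      by rewrite -subset0 => z [Az [_ []]].
    by apply: has_angle_sub aB => z [].
have nice_at x : X x -> exists2 A, nice A & A x.
  move=> Xx; have [m xm] := notE x (XE x Xx).
  have [rho rhoP] := orbK m.
  (* The component of [x] stays in the disc of radius [rho]; the margin 1 lets a clopen part of [XR]
     around it avoid the bounding circle, and thus be clopen in [X]. *)
  pose XR := X `&` [set z | normc z <= rho + 1].
  have cball : closed [set z : R[i] | normc z <= rho + 1].
    by apply: compact_closed; [exact: hausdorffC|exact: compact_closed_ballC].
  have cXR : closed XR by exact: closedI.
  have cptXR : compact XR by apply: (subclosed_compact cXR (@compact_closed_ballC R (rho + 1))) => z [].
  have xrho : orbit_le f rho x.
    apply: (rhoP [set x]) => //; first exact: connected1.
      by exists m => _ ->.
    by exists x.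
  have XRx : XR x by split => //=; apply: le_trans (xrho 0%N) _; rewrite lerDl.
  pose K := connected_component XR x.
  have KXR : K `<=` XR by exact: connected_component_sub.
  have cptK : compact K by apply: (subclosed_compact _ cptXR) => //; exact: component_closed.
  have Kx : K x by exact: connected_component_refl.
  have Krho : K `<=` orbit_le f rho.
    apply: rhoP; first exact: component_connected.
      apply: orbC => //; first exact: component_connected.
      by move=> z /KXR[/XE/notE].
    by exists x.
  have rho0 : 0 <= rho by exact: le_trans (normc_ge0 _) (xrho 0%N).
  have near_angle w : E w -> angle_near K w.
    move=> Ew; apply: contrapT => naw.
    have nKw : ~ K w by move=> /Krho; exact: Eorbit.
    have [G [oG Gw bG GK]] := no_angle_hole cptK nKw naw.
    apply: (Eorbit w Ew rho) => n; have [g gP] := cderiv_iter n ff'.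
    apply: (maximum_modulus rho0 gP oG bG) => // z clz nGz.
    (* The frontier of [G] lies in [K], so every iterate is bounded by [rho] on it, hence at [w],
       contradicting [E w]. *)
    by apply: Krho; exact: GK.
  have [V0 [oV0 KV0 a0]] := near_angle _ Ew0.
  have [V1 [oV1 KV1 a1]] := near_angle _ Ew1.
  pose O := V0 `&` V1 `&` [set z | normc z < rho + 1].
  have oball : open [set z : R[i] | normc z < rho + 1].
    apply: (open_comp (f := @normc R) (D := [set t | t < rho + 1])); last exact: open_lt.
    by move=> z _; exact: continuous_normc.
  have [|| A [cA cXRA AXR Ax] AO] := component_clopen_part (hausdorffC R) (@closed_sepC R) cptXR XRx (O := O).
  - by apply: openI => //; exact: openI.
  - move=> z Kz; split; first by split; [exact: KV0|exact: KV1].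
    by apply: le_lt_trans (Krho z Kz 0%N) _; rewrite ltrDl.
  exists A => //; split => //.
  - have -> : X `\` A = (XR `\` A) `|` (X `&` ~` [set z | normc z < rho + 1]).
      apply/seteqP; split => z.
        move=> [Xz nAz]; have [zr|zr] := leP (normc z) (rho + 1); [by left|right].
        by split => //= h'; have := lt_trans zr h'; rewrite ltxx.
      by move=> [[[Xz _] nAz]|[Xz nz]]; split => // /AO[_ /nz].
    by apply: closedU => //; apply: closedI => //; exact: open_closedC.
  - by move=> z /AXR[].
  - by exists (rho + 1) => z /AO[_].
  - apply: has_angleM; first by apply: has_angle_sub a0 => z /AO[[]].
    by apply: has_angleV; apply: has_angle_sub a1 => z /AO[[]].
pose r1 := normc w0 + normc w1 + normc w1.
(* The single nice part needed by [separated_no_angle] is obtained by compactness of the disc of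
   radius [r1]. *)
have [A nA XA] : exists2 A, nice A & [set z | normc z <= r1] `&` X `<=` A.
  apply: (compact_set_ind (P := fun S => exists2 A, nice A & S `&` X `<=` A) (@compact_closed_ballC R r1)).
  - by exists set0 => // z [].
  - move=> S S' [A nA SA] [A' nA' SA']; exists (A `|` A'); first exact: niceU.
    by move=> z [[Sz|Sz] Xz]; [left; exact: SA|right; exact: SA'].
  - by move=> S S' SS' [A nA S'A]; exists A => // z [/SS' S'z Xz]; exact: S'A.
  - move=> x _; have [Xx|nXx] := pselect (X x).
      have [A nA Ax] := nice_at x Xx; exists (~` (X `\` A)).
        apply: open_nbhs_nbhs; split; last by move=> [].
        by apply: closed_openC; case: nA.
      by exists A => // z [nz Xz]; apply: contrapT => nAz; apply: nz.
    exists (~` X); first by apply: open_nbhs_nbhs; split => //; exact: closed_openC.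
    by exists set0 => // z [].
case: nA => cA cXA AX bA; apply: (separated_no_angle oU0 oU1 U01 (FU0 _ F0w0) (FU1 _ F1w1)) => //.
by move=> z nU0z nU1z zr; apply: XA; split => // -[].
Qed.
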